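(* Let $\mathcal T$ be the set of algebraic virtual tangles without closed components, up to wink-equivalence. Then $\mathcal T$ is finite and is given by $$\mathcal T=\{X(u,v),\,H(u,v),\,V(u,v)\mid u,v\in\{0,1,2,3\}\},$$ where $$X(u,v)=U^u\ominus D^v\ominus\rho,\qquad H(u,v)=U^u\ominus D^v,\qquad V(u,v)=R^u\circledcirc L^v .$$
   Context: **Diagrams.** A virtual diagram (or simply diagram) is the image of a proper smooth immersion of a $1$-manifold (a disjoint union of finitely many circles and intervals) into a disk, whose singularities are transverse double points, each labelled as a classical crossing (with over/under information) or a virtual crossing. Proper means that the boundary of the $1$-manifold is mapped to the boundary of the disk. Diagrams are unoriented. **Welded isotopy.** The equivalence relation on diagrams generated by ambient isotopies of the disk fixing the boundary pointwise and the local moves: classical Reidemeister moves I, II, III; virtual Reidemeister moves I, II, III (the same moves with all crossings virtual); the mixed Reidemeister move (a strand meeting two other strands only in virtual crossings may be moved across a classical crossing of these two strands); the (OC)-move (a strand passing over two other strands, via two classical crossings, may be moved across a virtual crossing of these two strands). **Wink-move.** In a disk with boundary points TL, BL (left) and TR, BR (right), let $\ell$ be an arc joining TL to BL and bulging to the right, and $r$ an arc joining TR to BR and bulging to the left, so that $\ell$ and $r$ meet in exactly two points, an upper one and a lower one, bounding a bigon. One of these two points is a virtual crossing, and the other is a classical crossing at which $r$ passes over $\ell$ (two possibilities, according to whether the classical crossing is the upper or the lower one). Call this configuration $K$. Let $cK$ be the configuration obtained by inserting on the left of $K$ one classical crossing $c$ (of either of the two types) between the two left ends of $\ell$, so that $\ell$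 acquires one self-crossing. The wink-moves are the local moves $cK \leftrightarrow K$ (up to planar isotopy and rotation). All versions generate, with welded isotopy, the same equivalence relation. Wink-equivalence is the equivalence relation on diagrams generated by welded isotopy and wink-moves. **Tangles.** A virtual tangle is a virtual diagram in $[0,1]^2$ whose underlying $1$-manifold consists of two intervals and finitely many circles (the closed components), the endpoints of the intervals lying at the four corners of the square. The vertical stacking $T_1\circledcirc T_2$ places $T_1$ on top of $T_2$, gluing the bottom corners of $T_1$ to the top corners of $T_2$; the horizontal stacking $T_1\ominus T_2$ places $T_1$ to the left of $T_2$, gluing the right corners of $T_1$ to the left corners of $T_2$ (followed by rescaling to the unit square). The elementary tangles are $\sigma$, $\overline\sigma$, $\rho$, each consisting of the two diagonals of the square meeting in a single crossing: in $\sigma$ the crossing is classical with the bottom-left to top-right diagonal over; $\overline\sigma$ is obtained from $\sigma$ by exchanging over and under; in $\rho$ the crossing is virtual. An algebraic virtual tangle is any virtual tangle generated from $\sigma,\overline\sigma,\rho$ by the two stacking operations. **Special tangles.** $R=\overline\sigma\circledcirc\rho$, $L=\rho\circledcirc\overline\sigma$, $U=\sigma\ominus\rho$, $D=\rho\ominus\sigma$. Powers $R^u,L^v$ are with respect to $\circledcirc$, with zeroth power the tangle made of two parallel crossingless vertical strands; powers $U^u,D^v$ are with respect to $\ominus$, with zeroth power the tangle made of two parallel crossingless horizontal strands. *)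

(* Defs.v *)
From Stdlib Require Import Relation_Operators.
From mathcomp Require Import all_boot.
From mathcomp Require Import classical_sets cardinality.

Set Implicit Arguments.
Unset Strict Implicit.
Unset Printing Implicit Defensive.

(* A diagram in a square with m endpoints on the top side and n endpoints on
   the bottom side is put in general position with respect to the height
   function and recorded as the word of its height-critical events, read from
   top to bottom.  The event (i, p) is the piece p with exactly i strands to
   its left.  The pieces are a crossing of two strands running downwards, a
   local maximum [Cap] (two new strands below) and a local minimum [Cup] (two
   strands above are joined).

   A classical crossing is [Classical true] when the strand running from
   bottom left to top right is over, [Classical false] when it is the strand
   running from top left to bottom right. *)

Inductive crossing := Virtual | Classical of bool.

Inductive piece := Cross of crossing | Cap | Cup.

Definition event : Type := (nat * piece)%type.

Definition ins (p : piece) : nat := if p is Cap then 0 else 2.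
Definition outs (p : piece) : nat := if p is Cup then 0 else 2.

Definition next_width (m : nat) (s : event) : nat := m - ins s.2 + outs s.2.

Definition width (m : nat) (w : seq event) : nat := foldl next_width m w.

Fixpoint fits (m : nat) (w : seq event) (n : nat) : bool :=
  if w is s :: w' then (s.1 + ins s.2 <= m) && fits (next_width m s) w' n
  else m == n.

Record diagram (m n : nat) := Diagram {
  word :> seq event;
  word_fits : fits m word n
}.

Definition shift (k : nat) (w : seq event) : seq event :=
  [seq (k + s.1, s.2) | s <- w].

(* The label of a crossing after a quarter turn of the plane. *)
Definition turn (c : crossing) : crossing :=
  if c is Classical b then Classical (~~ b) else Virtual.

(* The 1-manifold underlying a diagram.  The point (k, j) is the j-th strand,
   from the left, between the (k-1)-th and the k-th event; [arc] relates two
   such points which are joined by a piece of strand inside one event.  A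
   strand goes straight through each crossing. *)

Inductive arc (w : seq event) : nat * nat -> nat * nat -> Prop :=
| ArcLeft k i p j :
    k < size w -> nth (0, Cap) w k = (i, p) -> j < i ->
    arc w (k, j) (k.+1, j)
| ArcRight k i p j :
    k < size w -> nth (0, Cap) w k = (i, p) ->
    arc w (k, i + ins p + j) (k.+1, i + outs p + j)
| ArcFall k i c :
    k < size w -> nth (0, Cap) w k = (i, Cross c) ->
    arc w (k, i) (k.+1, i.+1)
| ArcRise k i c :
    k < size w -> nth (0, Cap) w k = (i, Cross c) ->
    arc w (k, i.+1) (k.+1, i)
| ArcCap k i :
    k < size w -> nth (0, Cap) w k = (i, Cap) ->
    arc w (k.+1, i) (k.+1, i.+1)
| ArcCup k i :
    k < size w -> nth (0, Cap) w k = (i, Cup) ->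
    arc w (k, i) (k, i.+1).

Definition same_component (w : seq event) : nat * nat -> nat * nat -> Prop :=
  clos_refl_sym_trans (nat * nat) (arc w).

(* Every component reaches the boundary of the square. *)
Definition without_closed_components m n (D : diagram m n) : Prop :=
  forall k j, k <= size D -> j < width m (take k D) ->
  exists k' j', (k' = 0 \/ k' = size D) /\ same_component D (k, j) (k', j').

(* Planar isotopy of diagrams in general position: exchange of the heights of
   two events which are side by side, cancellation of a maximum against a
   neighbouring minimum, and sliding a crossing through a maximum or a minimum
   of one of its two strands. *)
Inductive planar_isotopy : seq event -> seq event -> Prop :=
| Exchange p q k :
    planar_isotopy [:: (0, p); (outs p + k, q)] [:: (ins p + k, q); (0, p)]
| ZigzagLeft : planar_isotopy [:: (0, Cap); (1, Cup)] [::]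
| ZigzagRight : planar_isotopy [:: (1, Cap); (0, Cup)] [::]
| SlideCap c :
    planar_isotopy [:: (1, Cap); (0, Cross c)] [:: (0, Cap); (1, Cross (turn c))]
| SlideCup c :
    planar_isotopy [:: (0, Cross c); (1, Cup)] [:: (1, Cross (turn c)); (0, Cup)].

(* Three strands x, y, z, numbered from left to right at the top, cross
   pairwise with labels [xy], [xz], [yz]; [triangle] moves the strand x across
   the crossing of y and z (equivalently z across that of x and y, or y across
   that of x and z).  The strand which comes from the left at the top of a
   crossing is over for [Classical false] and under for [Classical true]. *)
Inductive triangle (xy xz yz : crossing) : seq event -> seq event -> Prop :=
| Triangle :
    triangle xy xz yz
      [:: (0, Cross xy); (1, Cross xz); (0, Cross yz)]
      [:: (1, Cross yz); (0, Cross xz); (1, Cross xy)].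

(* It suffices to list each local move in one position with respect to the
   height function: a turned copy is obtained by bending the ends of the
   strands with planar isotopies. *)

(* In [ClassicalR3] the condition excludes the two labellings in which the
   strands are not layered one above the other. *)
Inductive reidemeister : seq event -> seq event -> Prop :=
| ClassicalR1 a :
    reidemeister [:: (0, Cap); (0, Cross (Classical a))] [:: (0, Cap)]
| ClassicalR2 a :
    reidemeister
      [:: (0, Cross (Classical a)); (0, Cross (Classical (~~ a)))] [::]
| ClassicalR3 a b c l r :
    b = a \/ b = c ->
    triangle (Classical a) (Classical b) (Classical c) l r -> reidemeister l r.

Inductive virtual_reidemeister : seq event -> seq event -> Prop :=
| VirtualR1 :
    virtual_reidemeister [:: (0, Cap); (0, Cross Virtual)] [:: (0, Cap)]
| VirtualR2 :
    virtual_reidemeister [:: (0, Cross Virtual); (0, Cross Virtual)] [::]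
| VirtualR3 l r :
    triangle Virtual Virtual Virtual l r -> virtual_reidemeister l r.

Inductive mixed_reidemeister : seq event -> seq event -> Prop :=
| MixedX a l r :
    triangle Virtual Virtual (Classical a) l r -> mixed_reidemeister l r
| MixedY a l r :
    triangle Virtual (Classical a) Virtual l r -> mixed_reidemeister l r
| MixedZ a l r :
    triangle (Classical a) Virtual Virtual l r -> mixed_reidemeister l r.

(* The strand x, y or z respectively is over the two others. *)
Inductive over_commute : seq event -> seq event -> Prop :=
| OverX l r :
    triangle (Classical false) (Classical false) Virtual l r -> over_commute l r
| OverY l r :
    triangle (Classical true) Virtual (Classical false) l r -> over_commute l r
| OverZ l r :
    triangle Virtual (Classical true) (Classical true) l r -> over_commute l r.

Inductive welded_move (l r : seq event) : Prop :=
| WeldedPlanar of planar_isotopy l r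
| WeldedClassical of reidemeister l r
| WeldedVirtual of virtual_reidemeister l r
| WeldedMixed of mixed_reidemeister l r
| WeldedOC of over_commute l r.

(* For words with two strands at the top and at the bottom: the top right end
   of w1 is joined to the top left end of w2 by a maximum, and the bottom right
   end of w1 to the bottom left end of w2 by a minimum. *)
Definition hcat (w1 w2 : seq event) : seq event :=
  (1, Cap) :: w1 ++ shift 2 w2 ++ [:: (1, Cup)].

(* The configuration K: l is the strand on the left at the top and at the
   bottom, r the one on the right, and r is over l at the classical crossing,
   which is the upper one when [upper] holds. *)
Definition wink_K (upper : bool) : seq event :=
  if upper then [:: (0, Cross (Classical true)); (0, Cross Virtual)]
  else [:: (0, Cross Virtual); (0, Cross (Classical false))].

Inductive wink : seq event -> seq event -> Prop :=
| Wink c upper :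
    wink (hcat [:: (0, Cross (Classical c))] (wink_K upper)) (wink_K upper).

(* One local move, performed somewhere inside a diagram. *)
Inductive local_step (move : seq event -> seq event -> Prop) m n
    (D D' : diagram m n) : Prop :=
| LocalStep u i l r v of
    move l r & word D = u ++ shift i l ++ v & word D' = u ++ shift i r ++ v.

Definition welded_isotopic m n : diagram m n -> diagram m n -> Prop :=
  clos_refl_sym_trans (diagram m n) (@local_step welded_move m n).

Definition wink_equivalent m n : diagram m n -> diagram m n -> Prop :=
  clos_refl_sym_trans (diagram m n)
    (fun D D' => welded_isotopic D D' \/ local_step wink D D').

(* The four endpoints are the corners of the square, so that the underlying
   1-manifold is made of two intervals and of circles. *)
Definition tangle : Type := diagram 2 2.

Lemma fits_cat l m n w1 w2 :
  fits l w1 m -> fits m w2 n -> fits l (w1 ++ w2) n.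
Proof.
elim: w1 l => [|s w1 IH] l /=; first by move=> /eqP ->.
by case/andP=> -> /IH fw /fw.
Qed.

Lemma fits_right k m n w : fits m w n -> fits (m + k) w (n + k).
Proof.
elim: w m => [|s w IH] m /=; first by move=> /eqP ->.
case/andP=> sm /IH; rewrite (leq_trans sm (leq_addr k m)) /=.
suff -> : next_width m s + k = next_width (m + k) s by [].
rewrite /next_width -addnBAC; last exact: leq_trans (leq_addl _ _) sm.
by rewrite addnAC.
Qed.

Lemma fits_shift k m n w : fits m w n -> fits (k + m) (shift k w) (k + n).
Proof.
elim: w m => [|s w IH] m /=; first by move=> /eqP ->.
case/andP=> sm /IH; rewrite -addnA leq_add2l sm /=.
suff -> : k + next_width m s = next_width (k + m) (k + s.1, s.2) by [].
rewrite /next_width -addnBA; last exact: leq_trans (leq_addl _ _) sm.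
by rewrite addnA.
Qed.

Lemma fits_hcat w1 w2 : fits 2 w1 2 -> fits 2 w2 2 -> fits 2 (hcat w1 w2) 2.
Proof.
move=> /(fits_right 2) f1 /(fits_shift 2) f2.
by apply: fits_cat f1 _; apply: fits_cat f2 _.
Qed.

Definition vstack (T1 T2 : tangle) : tangle :=
  Diagram (fits_cat (word_fits T1) (word_fits T2)).

Definition hstack (T1 T2 : tangle) : tangle :=
  Diagram (fits_hcat (word_fits T1) (word_fits T2)).

Definition elementary (c : crossing) : tangle :=
  @Diagram 2 2 [:: (0, Cross c)] isT.

Definition sigma : tangle := elementary (Classical true).
Definition sigma_bar : tangle := elementary (Classical false).
Definition rho : tangle := elementary Virtual.

Inductive algebraic : tangle -> Prop :=
| AlgSigma : algebraic sigma
| AlgSigmaBar : algebraic sigma_bar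
| AlgRho : algebraic rho
| AlgVstack T1 T2 : algebraic T1 -> algebraic T2 -> algebraic (vstack T1 T2)
| AlgHstack T1 T2 : algebraic T1 -> algebraic T2 -> algebraic (hstack T1 T2).

Definition vertical_strands : tangle := @Diagram 2 2 [::] isT.

Definition horizontal_strands : tangle :=
  @Diagram 2 2 [:: (0, Cup); (0, Cap)] isT.

Definition vpower (T : tangle) (u : nat) : tangle :=
  iterop u vstack T vertical_strands.

Definition hpower (T : tangle) (u : nat) : tangle :=
  iterop u hstack T horizontal_strands.

Definition tangleR : tangle := vstack sigma_bar rho.
Definition tangleL : tangle := vstack rho sigma_bar.
Definition tangleU : tangle := hstack sigma rho.
Definition tangleD : tangle := hstack rho sigma.

Definition tangleX (u v : nat) : tangle :=
  hstack (hstack (hpower tangleU u) (hpower tangleD v)) rho.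
Definition tangleH (u v : nat) : tangle :=
  hstack (hpower tangleU u) (hpower tangleD v).
Definition tangleV (u v : nat) : tangle :=
  vstack (vpower tangleR u) (vpower tangleL v).

Definition wink_class (T : tangle) : set tangle :=
  [set T' | wink_equivalent T T']%classic.

(* The set of the wink-equivalence classes of algebraic virtual tangles without
   closed components. *)
Definition algebraic_classes : set (set tangle) :=
  (wink_class @` [set T | algebraic T /\ without_closed_components T])%classic.

(* Main.v *)
(** A quarter turn of the square exchanges the two stackings, turns [R] into [U]
    and [L] into [D], and so reduces everything to the horizontal stacking.

    A strand that passes over a whole tangle may be moved across it; this gives
    [rho ⊖ (R^-1 ⊚ T) ~ (sigma ⊖ T) ⊚ R] for every [T].  The wink-move says that
    [sigma ⊖ L ~ L]; together with the previous identity and half turns it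
    yields [R L ~ L^-1 R^-1], [L R^-1 ~ R L^-1] and [U ⊖ L^2 ~ L^-2].  A
    wink-move on a self-crossing of one strand moreover gives
    [U^-1 ⊖ L^-2 ~ L^-2], hence [L^4 ~ 1].  So the tangles [R^u L^v] form a group
    under vertical stacking, with [u] and [v] modulo 4, and this set is preserved
    when [U], [D] or [rho] is stacked on either side.  Since
    [V ⊚ rho ~ rho ⊖ V'], where [V'] is the quarter turn of [V ⊖ rho], the union
    of the three families is closed under both stackings, except that [H ⊚ H] and
    [V ⊖ V] have a closed component. *)

Require Import Defs.
From mathcomp Require Import all_boot.
From mathcomp Require Import classical_sets cardinality.
From HB Require Import structures.
From mathcomp Require Import zify boolp.
From Stdlib Require Import Relation_Operators Setoid Morphisms.

Set Implicit Arguments.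
Unset Strict Implicit.
Unset Printing Implicit Defensive.

(** * Words up to equivalence *)

(** The isotopies are too long to be handled as proofs about words, so they are kept as data: a
    movie is a list of moves on words that may contain boxes for arbitrary tangles, and a checker,
    proved sound once, replays it by computation. Movies use welded moves only. The wink-move enters
    in [wink_L] and [wink_Li] alone; the rest is algebra with R, L, U and D. The algebraic relations
    come from evaluating rho ⊖ T for a product T and for its half turn. A factor R^-1 can be
    stripped from the top of T at the price of a U, or from the bottom at the price of a D, and the
    two values are compared. *)

Definition move_or_wink (l r : seq event) : Prop := welded_move l r \/ wink l r.

Lemma diagram_eq m n (D D' : diagram m n) : word D = word D' -> D = D'.
Proof.
case: D D' => w f [w' f'] /= e; rewrite e in f *.
by rewrite (bool_irrelevance f f').
Qed.

Lemma wink_equivalent_step m n (D D' : diagram m n) :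
  local_step move_or_wink D D' -> wink_equivalent D D'.
Proof.
case=> u i l r v [] lr eD eD'; apply: rst_step; last by right;
  apply: LocalStep lr eD eD'.
by left; apply: rst_step; apply: LocalStep lr eD eD'.
Qed.

(** Wink-equivalence is a closure of a closure; this reduces every congruence to a single local move
    of either kind. *)
Lemma wink_equivalent_map m n m' n' (f : diagram m n -> diagram m' n') :
  (forall D D', local_step move_or_wink D D' -> wink_equivalent (f D) (f D')) ->
  forall D D', wink_equivalent D D' -> wink_equivalent (f D) (f D').
Proof.
move=> fP D D'; elim=> [{}D {}D' [DD'|[u i l r v lr eD eD']]|{}D|{}D {}D' _|{}D
  D2 {}D' _ IH _].
- elim: DD' => [{}D {}D' [u i l r v lr eD eD']|{}D|{}D {}D' _|{}D D2 {}D' _ IH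
    _].
  + by apply: fP; apply: LocalStep eD eD'; left.
  + exact: rst_refl.
  + exact: rst_sym.
  + exact: rst_trans.
- by apply: fP; apply: LocalStep eD eD'; right.
- exact: rst_refl.
- exact: rst_sym.
- exact: rst_trans.
Qed.

(* Fails unless both words fit. *)
Definition weq m n (w w' : seq event) : Prop :=
  exists (f : fits m w n) (f' : fits m w' n),
    wink_equivalent (Diagram f) (Diagram f').

Lemma weqP m n (D D' : diagram m n) : weq m n D D' <-> wink_equivalent D D'.
Proof.
split=> [[f [f']]|]; last first.
  by exists (word_fits D), (word_fits D'); case: D D' H => [w f] [w' f'].
case: D D' f f' => [w f0] [w' f0'] /= f f'.
by rewrite (bool_irrelevance f f0) (bool_irrelevance f' f0').
Qed.

Lemma weq_refl m n w : fits m w n -> weq m n w w.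
Proof. by move=> f; exists f, f; apply: rst_refl. Qed.

Lemma weq_sym m n w w' : weq m n w w' -> weq m n w' w.
Proof. by case=> f [f' ww']; exists f', f; apply: rst_sym. Qed.

Lemma weq_trans m n w2 w1 w3 : weq m n w1 w2 -> weq m n w2 w3 -> weq m n w1 w3.
Proof.
case=> f1 [f2 e12] [f2' [f3 e23]]; exists f1, f3.
by apply: rst_trans e12 _; rewrite (bool_irrelevance f2 f2').
Qed.

Lemma weq_fits m n w w' : weq m n w w' -> fits m w n /\ fits m w' n.
Proof. by case=> f [f' _]. Qed.

Lemma weq_step m n u i l r v :
  move_or_wink l r -> fits m (u ++ shift i l ++ v) n ->
  fits m (u ++ shift i r ++ v) n ->
  weq m n (u ++ shift i l ++ v) (u ++ shift i r ++ v).
Proof.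
move=> lr f f'; exists f, f'; apply: wink_equivalent_step.
exact: (@LocalStep _ _ _ _ _ u i l r v).
Qed.

Lemma shift_cat k u v : shift k (u ++ v) = shift k u ++ shift k v.
Proof. exact: map_cat. Qed.

Lemma shift_shift k l w : shift k (shift l w) = shift (k + l) w.
Proof. by rewrite /shift -map_comp; apply: eq_map => -[i p] /=;
  rewrite addnA. Qed.

Lemma shift0 w : shift 0 w = w.
Proof. by rewrite /shift -[RHS]map_id; apply: eq_map => -[]. Qed.

Lemma fits_context p q m n i j u v w :
  fits p u (i + (m + j)) -> fits (i + (n + j)) v q -> fits m w n ->
  fits p (u ++ shift i w ++ v) q.
Proof.
move=> fu fv fw; apply: fits_cat fu _; apply: fits_cat fv.
exact/fits_shift/fits_right.
Qed.

(** The source of all congruences: a move inside [w] is a move of the surrounding diagram, with [i]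
    more strands on its left and the events of [u] and [v] around it. *)
Lemma weq_context p q m n i j u v w w' :
  fits p u (i + (m + j)) -> fits (i + (n + j)) v q -> weq m n w w' ->
  weq p q (u ++ shift i w ++ v) (u ++ shift i w' ++ v).
Proof.
move=> fu fv [f [f' ww']].
pose F (D : diagram m n) := Diagram (fits_context fu fv (word_fits D)).
exists (fits_context fu fv f), (fits_context fu fv f').
apply: (@wink_equivalent_map _ _ _ _ F _ (Diagram f) (Diagram f')) ww' => D D'
  [u' i' l r v' lr eD eD'].
apply: wink_equivalent_step.
apply: (@LocalStep _ _ _ _ _ (u ++ shift i u') (i + i') l r (shift i v' ++ v))
  => //=.
  by rewrite eD !shift_cat shift_shift !catA.
by rewrite eD' !shift_cat shift_shift !catA.
Qed.

Lemma weq_cat m n p u u' v v' :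
  weq m n u u' -> weq n p v v' -> weq m p (u ++ v) (u' ++ v').
Proof.
move=> uu' vv'; have [[fu fu'] [fv fv']] := (weq_fits uu', weq_fits vv').
apply: (@weq_trans _ _ (u' ++ v)).
  by have := @weq_context m p m n 0 0 [::] v u u';
    rewrite !shift0 !addn0 add0n /=; apply.
have := @weq_context m p n p 0 0 u' [::] v v';
  rewrite !shift0 !addn0 !add0n !cats0.
by apply => //=.
Qed.

Lemma weq_shift k m n w w' : weq m n w w' ->
  weq (k + m) (k + n) (shift k w) (shift k w').
Proof.
move=> ww'; have := @weq_context (k + m) (k + n) m n k 0 [::] [::] w w'.
by rewrite !addn0 !cats0; apply => //=.
Qed.

Lemma weq_right k m n w w' : weq m n w w' -> weq (m + k) (n + k) w w'.
Proof.
move=> ww'; have := @weq_context (m + k) (n + k) m n 0 k [::] [::] w w'.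
by rewrite !shift0 !cats0; apply => //=.
Qed.

Lemma weq_event_exchange m s w p q :
  s.1 + ins s.2 <= m -> fits p w q ->
  weq (m + p) (next_width m s + q)
    (s :: shift (next_width m s) w) (shift m w ++ [:: s]).
Proof.
case: s => i s /=; set n := next_width m _ => sm.
have nE : n = m - ins s + outs s by [].
have fs k : fits (m + k) [:: (i, s)] (n + k).
  by apply: (@fits_right k m n [:: (i, s)]); rewrite /= sm /n eqxx.
elim: w p => [|[j t] w IH] p; first by move/eqP <-; exact/weq_refl/fs.
case/andP=> /= tp; set p' := next_width p (j, t) => fw.
have fw' : fits (n + p') (shift n w) (n + q) by apply: fits_shift.
have ft k : fits (k + p) [:: (k + j, t)] (k + p').
  by apply: (@fits_shift k p p' [:: (j, t)]); rewrite /= tp /p' eqxx.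
have sk k : fits (m + k) [:: (i, s)] (n + k) by [].
apply: (@weq_trans _ _ ((m + j, t) :: (i, s) :: shift n w)); last first.
  have := @weq_cat (m + p) (m + p') (n + q) [:: (m + j, t)] [:: (m + j, t)].
  by apply; [exact/weq_refl/ft | exact: IH].
(* Between [s] and [t] lie the [m - i - ins s] strands of the left block to the right of [s] and the
   first [j] strands of the right block: this is the gap [k] of [Exchange]. *)
have e1 : n + j = i + (outs s + (m - i - ins s + j)) by lia.
have e2 : m + j = i + (ins s + (m - i - ins s + j)) by lia.
have f1 : fits (m + p) [:: (i, s); (n + j, t)] (n + p').
  by apply: (@fits_cat _ (n + p) _ [:: (i, s)]); [exact: fs | exact: ft].
have f2 : fits (m + p) [:: (m + j, t); (i, s)] (n + p').
  by apply: (@fits_cat _ (m + p') _ [:: (m + j, t)]); [exact: ft | exact: fs].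
apply: (@weq_cat _ (n + p') _ [:: (i, s); (n + j, t)] [:: (m + j, t); (i, s)]).
  have := @weq_step (m + p) (n + p') [::] i _ _ [::]
     (or_introl (WeldedPlanar (Exchange s t (m - i - ins s + j)))).
  by rewrite /= -e1 -e2 !addn0; apply.
exact: weq_refl.
Qed.

Lemma weq_interchange m n p q w1 w2 :
  fits m w1 n -> fits p w2 q ->
  weq (m + p) (n + q) (w1 ++ shift n w2) (shift m w2 ++ w1).
Proof.
elim: w1 m => [|s w1 IH] m.
  by move/eqP <- => f2; rewrite cats0; apply/weq_refl/fits_shift.
case/andP=> sm f1 f2; set m' := next_width m s in f1.
have fs k : fits (m + k) [:: s] (m' + k).
  by apply: (@fits_right k m m' [:: s]); rewrite /= sm eqxx.
apply: (@weq_trans _ _ (s :: shift m' w2 ++ w1)).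
  by apply: (@weq_cat _ (m' + p) _ [:: s] [:: s]);
    [exact/weq_refl/fs | exact: IH].
rewrite -cat_cons -[s :: w1]cat1s catA.
apply: (@weq_cat _ (m' + q)); first exact: weq_event_exchange.
exact/weq_refl/fits_right.
Qed.

(** * Moving a strand across a tangle *)

(* The strand coming from the left at the top is over or virtual, so that it may
   be moved across any crossing of two other strands. *)
Definition over_left (x : crossing) : bool :=
  if x is Classical b then ~~ b else true.

Definition pass_right (x : crossing) (m : nat) : seq event :=
  [seq (i, Cross x) | i <- iota 0 m].

(** A table of the labellings for which a triangle is a welded move: at least two virtual crossings,
    a layered classical triangle, or a strand over a virtual crossing. *)
Definition layered (a b c : crossing) : bool :=
  match a, b, c with
  | Virtual, Virtual, _ | Virtual, _, Virtual | _, Virtual, Virtual => true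
  | Classical a, Classical b, Classical c => (b == a) || (b == c)
  | Classical a, Classical b, Virtual => ~~ a && ~~ b
  | Classical a, Virtual, Classical c => a && ~~ c
  | Virtual, Classical b, Classical c => b && c
  end.

Lemma layered_move a b c l r :
  layered a b c -> triangle a b c l r -> welded_move l r.
Proof.
case: a b c => [|a] [|b] [|c] //= h lr.
- by apply: WeldedVirtual; apply: VirtualR3.
- by apply: WeldedMixed; apply: MixedX lr.
- by apply: WeldedMixed; apply: MixedY lr.
- by case: b c h lr => [] [] // _ lr; apply: WeldedOC; apply: OverZ.
- by apply: WeldedMixed; apply: MixedZ lr.
- by case: a c h lr => [] [] // _ lr; apply: WeldedOC; apply: OverY.
- by case: a b h lr => [] [] // _ lr; apply: WeldedOC; apply: OverX.
- apply: WeldedClassical; apply: ClassicalR3 lr.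
  by case/orP: h => /eqP->; [left | right].
Qed.

Lemma pass_rightD x m n :
  pass_right x (m + n) = pass_right x m ++ shift m (pass_right x n).
Proof.
rewrite /pass_right iotaD map_cat add0n; congr (_ ++ _).
by rewrite -[in LHS](addn0 m) iotaDl /shift -!map_comp; apply: eq_map.
Qed.

Lemma pass_right_fits x m : fits m.+1 (pass_right x m) m.+1.
Proof.
elim: m => [|m IH] //; have := pass_rightD x m 1; rewrite addn1 => ->.
apply: (@fits_cat _ m.+2); last by rewrite /= addn0 addn2 leqnn /next_width /=
  subnK.
by have := fits_right 1 IH; rewrite !addn1.
Qed.

Lemma weq_bigon a m :
  weq m.+2 m.+2 [:: (m, Cross (turn a)); (m, Cross a)] [::].
Proof.
have fb : fits m.+2 [:: (m, Cross (turn a)); (m, Cross a)] m.+2.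
  by rewrite /= /next_width /=; lia.
have := @weq_step m.+2 m.+2 [::] m [:: (0, Cross (turn a));
  (0, Cross a)] [::] [::].
rewrite [shift _ _ ++ _]/= addn0; apply=> //; last exact: eqxx.
left; case: a {fb} => [|c]; first by apply: WeldedVirtual; apply: VirtualR2.
by apply: WeldedClassical; have := ClassicalR2 (~~ c); rewrite negbK.
Qed.

Lemma turnK : involutive turn. Proof. by case=> [|[]]. Qed.
(** A crossing is passed by a triangle with labels [x], [x], [c], allowed because [x] is over or
    virtual; a maximum or minimum is passed by a slide, with a bigon that cancels. *)
Lemma weq_pass_event x p :
  over_left x ->
  weq (ins p).+1 (outs p).+1 (rcons (pass_right x (ins p)) (0, p))
    ((1, p) :: pass_right x (outs p)).
Proof.
move=> xl; case: p => [c||].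
- have lay : layered x x c by case: x c xl => [|[]] [|[]].
  have := @weq_step 3 3 [::] 0 _ _ [::] (or_introl (layered_move lay (Triangle
    x x c))).
  by rewrite !shift0; apply.
- apply: weq_sym; apply: (@weq_trans _ _ [:: (0, Cap); (1, Cross (turn x));
    (1, Cross x)]).
    have := @weq_step 1 3 [::] 0 _ _ [:: (1,
      Cross x)] (or_introl (WeldedPlanar (SlideCap x))).
    by rewrite !shift0; apply.
  apply: (@weq_cat 1 3 3 [:: (0, Cap)] [:: (0, Cap)] [:: (1, Cross (turn x));
    (1, Cross x)] [::]); last exact: weq_bigon.
  exact: weq_refl.
- apply: (@weq_trans _ _ [:: (0, Cross x); (0, Cross (turn x)); (1, Cup)]).
    apply: weq_sym.
    have := @weq_step 3 1 [:: (0,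
      Cross x)] 0 _ _ [::] (or_introl (WeldedPlanar (SlideCup (turn x)))).
    by rewrite !shift0 turnK; apply.
  apply: (@weq_cat 3 3 1 [:: (0, Cross x);
    (0, Cross (turn x))] [::] [:: (1, Cup)] [:: (1, Cup)]);
      last exact: weq_refl.
  by have := @weq_right 1 _ _ _ _ (weq_bigon (turn x) 0); rewrite turnK.
Qed.

(** The passage is cut into the strands left of [p], those entering [p] and those right of it. Only
    the middle part meets [p]; the outer two change height with it. *)
Lemma weq_pass_shifted x i p j :
  over_left x ->
  weq (i + (ins p + j)).+1 (i + (outs p + j)).+1
    (pass_right x (i + (ins p + j)) ++ [:: (i, p)])
    ((i.+1, p) :: pass_right x (i + (outs p + j))).
Proof.
move=> xl; rewrite !pass_rightD !shift_cat !shift_shift.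
have fpj : fits j.+1 (pass_right x j) j.+1 := pass_right_fits x j.
have fp : fits (i + ins p) [:: (i, p)] (i + outs p).
  by rewrite /= leqnn /next_width /=; apply/eqP; lia.
have E1 : weq (i + (ins p + j)).+1 (i + (outs p + j)).+1
    (pass_right x i ++ shift i (pass_right x (ins p)) ++
       shift (i + ins p) (pass_right x j) ++ [:: (i, p)])
    (pass_right x i ++ shift i (pass_right x (ins p)) ++
       [:: (i, p)] ++ shift (i + outs p) (pass_right x j)).
  apply: (@weq_cat _ (i + (ins p + j)).+1).
    apply: weq_refl; rewrite -addSn; exact/fits_right/pass_right_fits.
  apply: (@weq_cat _ (i + (ins p + j)).+1).
    apply: weq_refl; rewrite -addnS -addSn; apply/fits_shift/fits_right.
    exact: pass_right_fits.
  by apply: weq_sym; rewrite !addnA -!addnS; exact: weq_interchange.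
have E2 : weq (i + (ins p + j)).+1 (i + (outs p + j)).+1
    (pass_right x i ++ (shift i (rcons (pass_right x (ins p)) (0, p))) ++
       shift (i + outs p) (pass_right x j))
    (pass_right x i ++ (shift i ((1, p) :: pass_right x (outs p))) ++
       shift (i + outs p) (pass_right x j)).
  apply: (@weq_cat _ (i + (ins p + j)).+1).
    apply: weq_refl; rewrite -addSn; exact/fits_right/pass_right_fits.
  apply: (@weq_cat _ (i + (outs p + j)).+1).
    by have := weq_shift i (weq_right j (weq_pass_event p xl));
      rewrite !addSn !addnS.
  by apply: weq_refl; rewrite addnA -addnS; apply: fits_shift.
have E3 : weq (i + (ins p + j)).+1 (i + (outs p + j)).+1
    ((pass_right x i ++ shift i.+1 [:: (0, p)]) ++
       shift i (pass_right x (outs p)) ++ shift (i + outs p) (pass_right x j))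
    ((shift i.+1 [:: (0, p)] ++ pass_right x i) ++
       shift i (pass_right x (outs p)) ++ shift (i + outs p) (pass_right x j)).
  apply: (@weq_cat _ (i + (outs p + j)).+1).
    rewrite -!addSn; apply: weq_interchange; first exact: pass_right_fits.
    by rewrite /= leq_addr /next_width /=; apply/eqP; lia.
  apply: weq_refl; apply: (@fits_cat _ (i + (outs p + j)).+1).
    rewrite -addnS -addSn; apply/fits_shift/fits_right; exact: pass_right_fits.
  by rewrite addnA -addnS; apply: fits_shift.
move: E2 E3; rewrite -cats1 shift_cat /= !addn0 !addn1 -?catA /= => E2 E3.
rewrite -?catA; exact: weq_trans E1 (weq_trans E2 E3).
Qed.

Lemma weq_pass x m n w :
  over_left x -> fits m w n ->
  weq m.+1 n.+1 (pass_right x m ++ w) (shift 1 w ++ pass_right x n).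
Proof.
move=> xl; elim: w m => [|[i p] w IH] m /=.
  by move/eqP <-; rewrite cats0; apply/weq_refl/pass_right_fits.
case/andP=> pm; set m' := next_width m _ => fw.
have mE : m = i + (ins p + (m - (i + ins p))) by lia.
have m'E : m' = i + (outs p + (m - (i + ins p))) by rewrite /m' /next_width /=;
  lia.
have := weq_pass_shifted i p (m - (i + ins p)) xl.
rewrite -mE -m'E -[_ :: _]cat1s => E.
apply: (@weq_trans _ _ ([:: (i.+1, p)] ++ (pass_right x m' ++ w))).
  rewrite -[_ :: w]cat1s !catA; apply: (weq_cat E).
  by apply: weq_refl; have := fits_right 1 fw; rewrite !addn1.
apply: (@weq_cat _ m'.+1 _ [:: (i.+1, p)] [:: (1 + i, p)]); last exact: IH.
by apply: weq_refl; apply: (@fits_shift 1 _ _ [:: (i, p)]);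
  rewrite /= pm /= eqxx.
Qed.

(** * Movies *)

(* [Box j] stands for an arbitrary tangle, the j-th one of a list of parameters. *)
Inductive xpiece := Piece of piece | Box of nat.

(** The coding gives [xpiece] a computable equality, with which the checker compares words. *)
Definition xpiece_code (p : xpiece) : nat :=
  match p with
  | Piece (Cross Virtual) => 0
  | Piece (Cross (Classical b)) => if b then 1 else 2
  | Piece Cap => 3
  | Piece Cup => 4
  | Box j => j + 5
  end.

Definition xpiece_decode (k : nat) : xpiece :=
  match k with
  | 0 => Piece (Cross Virtual)
  | 1 => Piece (Cross (Classical true))
  | 2 => Piece (Cross (Classical false))
  | 3 => Piece Cap
  | 4 => Piece Cup
  | k.+1.+4 => Box k
  end.

Lemma xpiece_codeK : cancel xpiece_code xpiece_decode.
Proof. by case=> [[[|[]]||]|j] //; rewrite /= !addnS addn0. Qed.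

HB.instance Definition _ := Equality.copy xpiece (can_type xpiece_codeK).

Definition xword : Type := seq (nat * xpiece).

Definition xins (p : xpiece) : nat := if p is Piece p then ins p else 2.
Definition xouts (p : xpiece) : nat := if p is Piece p then outs p else 2.

Definition xshift (k : nat) (w : xword) : xword :=
  [seq (k + s.1, s.2) | s <- w].

Definition xwidth (m : nat) (w : xword) : nat :=
  foldl (fun m s => m - xins s.2 + xouts s.2) m w.

Fixpoint xfits (m : nat) (w : xword) (n : nat) : bool :=
  if w is s :: w' then
    (s.1 + xins s.2 <= m) && xfits (m - xins s.2 + xouts s.2) w' n
  else m == n.

Definition expand_piece (Ts : seq tangle) (p : xpiece) : seq event :=
  match p with
  | Piece p => [:: (0, p)]
  | Box j => nth vertical_strands Ts j
  end.

Definition expand (Ts : seq tangle) (w : xword) : seq event :=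
  flatten [seq shift s.1 (expand_piece Ts s.2) | s <- w].

Lemma expand_piece_fits Ts p : fits (xins p) (expand_piece Ts p) (xouts p).
Proof. by case: p => [[c||]|j] //=; apply: word_fits. Qed.

Lemma expand_cat Ts u v : expand Ts (u ++ v) = expand Ts u ++ expand Ts v.
Proof. by rewrite /expand map_cat flatten_cat. Qed.

Lemma expand_shift Ts k w : expand Ts (xshift k w) = shift k (expand Ts w).
Proof.
elim: w => [|[i p] w IH] //.
by rewrite /xshift map_cons -[LHS]/(shift _ _ ++ expand Ts (xshift k w)) IH
  shift_cat shift_shift.
Qed.

Lemma expand_fits Ts m w n : xfits m w n -> fits m (expand Ts w) n.
Proof.
elim: w m => [|[i p] w IH] m //=; case/andP=> im /IH; apply: fits_cat.
have := fits_shift i (fits_right (m - (i + xins p)) (expand_piece_fits Ts p)).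
by have [-> ->] : i + (xins p + (m - (i + xins p))) = m /\
  i + (xouts p + (m - (i + xins p))) = m - xins p + xouts p by lia.
Qed.

(** Besides the moves on crossings there are two rules for boxes: [Exch] changes the heights of any
    two pieces, boxes included, and [Through] moves a strand across a box by [weq_pass]. There is no
    rule for the wink-move. *)
Inductive rule :=
| Exch of xpiece & xpiece & nat
| Zig of bool
| OverCap of crossing
| OverCup of crossing
| Kink of crossing
| Bigon of crossing
| Tri of crossing & crossing & crossing
| Through of crossing & nat.

Definition valid (r : rule) : bool :=
  match r with
  | Tri a b c => layered a b c
  | Through x _ => over_left x
  | _ => true
  end.

Definition arity (r : rule) : nat * nat :=
  match r with
  | Exch p q k => (xins p + (k + xins q), xouts p + (k + xouts q))
  | Zig _ => (1, 1)
  | OverCap _ => (1, 3)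
  | OverCup _ => (3, 1)
  | Kink _ => (0, 2)
  | Bigon _ => (2, 2)
  | Tri _ _ _ | Through _ _ => (3, 3)
  end.

Definition cross (i : nat) (c : crossing) : nat * xpiece := (i,
  Piece (Cross c)).
Definition cap (i : nat) : nat * xpiece := (i, Piece Cap).
Definition cup (i : nat) : nat * xpiece := (i, Piece Cup).

Definition sides (r : rule) : xword * xword :=
  match r with
  | Exch p q k => ([:: (0, p); (xouts p + k, q)], [:: (xins p + k, q); (0, p)])
  | Zig b => ([:: cap (~~ b); cup b], [::])
  | OverCap c => ([:: cap 1; cross 0 c], [:: cap 0; cross 1 (turn c)])
  | OverCup c => ([:: cross 0 c; cup 1], [:: cross 1 (turn c); cup 0])
  | Kink c => ([:: cap 0; cross 0 c], [:: cap 0])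
  | Bigon c => ([:: cross 0 c; cross 0 (turn c)], [::])
  | Tri a b c =>
      ([:: cross 0 a; cross 1 b; cross 0 c], [:: cross 1 c; cross 0 b;
        cross 1 a])
  | Through x j =>
      ([:: cross 0 x; cross 1 x; (0, Box j)], [:: (1, Box j); cross 0 x;
        cross 1 x])
  end.

Lemma weq_move m n l r :
  move_or_wink l r -> fits m l n -> fits m r n -> weq m n l r.
Proof.
move=> lr fl fr; have := @weq_step m n [::] 0 l r [::] lr.
by rewrite /= !cats0 !shift0; apply.
Qed.

Lemma rule_sound Ts r :
  valid r ->
  weq (arity r).1 (arity r).2 (expand Ts (sides r).1) (expand Ts (sides r).2).
Proof.
case: r => [p q k|b|c|c|c|c|a b c|x j] /= v.
- have := weq_interchange (expand_piece_fits Ts p)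
    (fits_shift k (expand_piece_fits Ts q)).
  by rewrite !shift_shift /expand /= !cats0 !shift0.
- apply: weq_move; [|by case: b..]; left; apply: WeldedPlanar.
  by case: b; [apply: ZigzagLeft | apply: ZigzagRight].
- by apply: weq_move => //; left; apply: WeldedPlanar; apply: SlideCap.
- by apply: weq_move => //; left; apply: WeldedPlanar; apply: SlideCup.
- apply: weq_move => //; left; case: c => [|a].
    by apply: WeldedVirtual; apply: VirtualR1.
  by apply: WeldedClassical; apply: ClassicalR1.
- by rewrite -[c in cross 0 c :: _]turnK; apply: weq_bigon.
- by apply: weq_move => //; left; apply: (layered_move v).
- have := weq_pass v (word_fits (nth vertical_strands Ts j)).
  by rewrite /expand /= cats0 shift0.
Qed.

(* [Sw k] and [Ws k] exchange the events k and k + 1; [Do r k i] applies the rule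
   [r] from left to right, and [Un r k i] from right to left,
     from the event k on
   and with i strands at its left. *)
Inductive move := Sw of nat | Ws of nat | Do of rule & nat & nat | Un of rule &
  nat & nat.

(** All side conditions are tested here, so that an illegal move yields [None] and a movie leaves
    nothing to prove but a computation. *)
Definition rewrite_at (m n : nat) (l r : xword) (ab : nat * nat) (k i : nat) (w
  : xword) : option xword :=
  let: (a, b) := ab in
  let u := take k w in
  let v := drop (k + size l) w in
  let m' := xwidth m u in
  let n' := m' - a + b in
  if [&& w == u ++ xshift i l ++ v, i + a <= m', xfits m u m', xfits n' v n &
      xfits m (u ++ xshift i r ++ v) n]
  then Some (u ++ xshift i r ++ v) else None.

(** The gap between exchanged pieces is read off their positions. If they are not side by side, the
    truncated subtraction gives a wrong gap and the equality test of [rewrite_at] fails. *)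
Definition perform (m n : nat) (mv : move) (w : xword) : option xword :=
  let go r (fwd : bool) k i :=
    let: (x, y) := sides r in
    if valid r then
      if fwd then rewrite_at m n x y (arity r) k i w
      else rewrite_at m n y x (arity r) k i w
    else None in
  match mv with
  | Do r k i => go r true k i
  | Un r k i => go r false k i
  | Sw k =>
      if drop k w is (i, p) :: (j, q) :: _ then
        go (Exch p q (j - i - xouts p)) true k i else None
  | Ws k =>
      if drop k w is (i, p) :: (j, q) :: _ then
        go (Exch q p (i - j - xins q)) false k j else None
  end.

Definition play (m n : nat) (mvs : seq move) (w : xword) : option xword :=
  foldl (fun o mv => obind (perform m n mv) o) (Some w) mvs.

Lemma rewrite_at_sound Ts m n l r a b k i w w' :
  weq a b (expand Ts l) (expand Ts r) ->
  rewrite_at m n l r (a, b) k i w = Some w' ->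
  weq m n (expand Ts w) (expand Ts w') /\ xfits m w' n.
Proof.
move=> lr; rewrite /rewrite_at;
  case: ifP => // /and5P[/eqP wE im fu fv fw'] [<-].
split=> //; rewrite {1}wE !expand_cat !expand_shift.
set m' := xwidth _ _ in im fu fv *.
apply: (@weq_context _ _ a b i (m' - (i + a))) => //.
  have -> : i + (a + (m' - (i + a))) = m' by lia.
  exact: expand_fits.
have -> : i + (b + (m' - (i + a))) = m' - a + b by lia.
exact: expand_fits.
Qed.

Lemma perform_sound Ts m n mv w w' :
  perform m n mv w = Some w' ->
  weq m n (expand Ts w) (expand Ts w') /\ xfits m w' n.
Proof.
have go r (fwd : bool) k i : (let: (x, y) := sides r in
    if valid r then
      if fwd then rewrite_at m n x y (arity r) k i w
      else rewrite_at m n y x (arity r) k i w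
    else None) = Some w' ->
    weq m n (expand Ts w) (expand Ts w') /\ xfits m w' n.
  have := @rule_sound Ts r; case: (sides r) (arity r) => [x y] [a b].
  case: (valid r) => // /(_ isT) xy; case: fwd; first exact: rewrite_at_sound.
  exact: rewrite_at_sound (weq_sym xy).
case: mv => [k|k|r k i|r k i] /=.
- by case: (drop k w) => [|[i p] [|[j q] v]] //; exact: (go (Exch _ _ _) true).
- by case: (drop k w) => [|[i p] [|[j q] v]] //; exact: (go (Exch _ _ _) false).
- exact: (go r true k i).
- exact: (go r false k i).
Qed.

Lemma play_sound Ts m n mvs w w' :
  xfits m w n -> play m n mvs w = Some w' ->
  weq m n (expand Ts w) (expand Ts w').
Proof.
rewrite /play; elim: mvs w => [|mv mvs IH] w fw /=.
  by case=> <-; apply/weq_refl/expand_fits.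
case E: (perform m n mv w) => [w1|] /=; last first.
  by have -> : foldl (fun o mv => obind (perform m n mv) o) None mvs = None by
    elim: (mvs).
have [ww1 fw1] := perform_sound Ts E; move/(IH _ fw1); exact: weq_trans.
Qed.

(** * Tangle expressions and the movies between them *)

Lemma fits_turn_cw (T : tangle) : fits 2 ((2, Cap) :: shift 1 T ++ [:: (0,
  Cup)]) 2.
Proof. exact: (fits_cat (fits_right 1 (fits_shift 1 (word_fits T)))). Qed.
Lemma fits_turn_ccw (T : tangle) : fits 2 ((0, Cap) :: shift 1 T ++ [:: (2,
  Cup)]) 2.
Proof. exact: (fits_cat (fits_right 1 (fits_shift 1 (word_fits T)))). Qed.
Lemma fits_undercross (T : tangle) :
  fits 2 ((1, Cap) :: shift 2 T ++
    [:: (1, Cross (Classical true)); (1, Cross Virtual); (0, Cup)]) 2.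
Proof. exact: (fits_cat (fits_shift 2 (word_fits T))). Qed.

Definition turn_cw (T : tangle) : tangle := Diagram (fits_turn_cw T).
Definition turn_ccw (T : tangle) : tangle := Diagram (fits_turn_ccw T).
(** A drawing of [(rho ⊖ sigma_bar) ⊖ T], by [tangleUi_undercross], in which the strand from the top
    left meets only the bottom left end of [T]. *)
Definition undercross (T : tangle) : tangle := Diagram (fits_undercross T).

(** Syntax with two readings, as a tangle and as a word with boxes: the ends of a movie are stated
    as tangles while the checker runs on words. *)
Inductive expr :=
| EBox of nat | ECross of crossing | EOne | EHone
| EV of expr & expr | EH of expr & expr
| ECw of expr | ECcw of expr | EUnder of expr.

Fixpoint tangle_of (Ts : seq tangle) (e : expr) : tangle :=
  match e with
  | EBox j => nth vertical_strands Ts j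
  | ECross c => elementary c
  | EOne => vertical_strands
  | EHone => horizontal_strands
  | EV e f => vstack (tangle_of Ts e) (tangle_of Ts f)
  | EH e f => hstack (tangle_of Ts e) (tangle_of Ts f)
  | ECw e => turn_cw (tangle_of Ts e)
  | ECcw e => turn_ccw (tangle_of Ts e)
  | EUnder e => undercross (tangle_of Ts e)
  end.

Fixpoint xword_of (e : expr) : xword :=
  match e with
  | EBox j => [:: (0, Box j)]
  | ECross c => [:: cross 0 c]
  | EOne => [::]
  | EHone => [:: cup 0; cap 0]
  | EV e f => xword_of e ++ xword_of f
  | EH e f => cap 1 :: xword_of e ++ xshift 2 (xword_of f) ++ [:: cup 1]
  | ECw e => cap 2 :: xshift 1 (xword_of e) ++ [:: cup 0]
  | ECcw e => cap 0 :: xshift 1 (xword_of e) ++ [:: cup 2]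
  | EUnder e => cap 1 :: xshift 2 (xword_of e) ++
      [:: cross 1 (Classical true); cross 1 Virtual; cup 0]
  end.

Lemma expand_xword_of Ts e : expand Ts (xword_of e) = tangle_of Ts e.
Proof.
elim: e => [j|c|||e IHe f IHf|e IHe f IHf|e IHe|e IHe|e IHe] //=.
- by rewrite /expand /= cats0 shift0.
- by rewrite expand_cat IHe IHf.
- by rewrite -cat1s !expand_cat expand_shift IHe IHf.
- by rewrite -cat1s !expand_cat expand_shift IHe.
- by rewrite -cat1s !expand_cat expand_shift IHe.
- by rewrite -cat1s !expand_cat expand_shift IHe.
Qed.

Definition shows (e f : expr) (mvs : seq move) : bool :=
  xfits 2 (xword_of e) 2 && (play 2 2 mvs (xword_of e) == Some (xword_of f)).

Local Notation "T ≈ T'" := (@wink_equivalent 2 2 T T') (at level 70).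

Lemma movie_sound Ts e f mvs :
  shows e f mvs -> tangle_of Ts e ≈ tangle_of Ts f.
Proof.
case/andP=> fe /eqP /(play_sound Ts fe); rewrite !expand_xword_of;
  exact: (proj1 (weqP _ _)).
Qed.

(* The lists of moves below were found by a bidirectional search. *)
Local Notation vc := Virtual.
Local Notation tc := (Classical true).
Local Notation fc := (Classical false).

Lemma hstackA (T T1 T2 : tangle) :
  hstack (hstack T T1) T2 ≈ hstack T (hstack T1 T2).
Proof.
apply: (@movie_sound [:: T; T1; T2] (EH (EH (EBox 0) (EBox 1)) (EBox 2))
  (EH (EBox 0) (EH (EBox 1) (EBox 2)))
  [:: Ws 0; Ws 1; Sw 4; Sw 5]).
by vm_compute.
Qed.

Lemma hstack1 (T : tangle) :
  hstack horizontal_strands T ≈ T.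
Proof.
apply: (@movie_sound [:: T] (EH EHone (EBox 0))
  (EBox 0)
  [:: Sw 2; Do (Zig false) 0 0; Do (Zig true) 1 0]).
by vm_compute.
Qed.

Lemma hstackr1 (T : tangle) :
  hstack T horizontal_strands ≈ T.
Proof.
apply: (@movie_sound [:: T] (EH (EBox 0) EHone)
  (EBox 0)
  [:: Sw 1; Do (Zig false) 3 1; Do (Zig true) 0 1]).
by vm_compute.
Qed.

Lemma ccw_vstack (T T1 : tangle) :
  turn_ccw (vstack T T1) ≈ hstack (turn_ccw T) (turn_ccw T1).
Proof.
apply: (@movie_sound [:: T; T1] (ECcw (EV (EBox 0) (EBox 1)))
  (EH (ECcw (EBox 0)) (ECcw (EBox 1)))
  [:: Un (Zig false) 2 1; Sw 3; Un (Zig false) 2 2; Sw 1; Sw 0; Sw 6]).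
by vm_compute.
Qed.

Lemma ccw_hstack (T T1 : tangle) :
  turn_ccw (hstack T T1) ≈ vstack (turn_ccw T1) (turn_ccw T).
Proof.
apply: (@movie_sound [:: T; T1] (ECcw (EH (EBox 0) (EBox 1)))
  (EV (ECcw (EBox 1)) (ECcw (EBox 0)))
  [:: Sw 0; Sw 2; Sw 1; Sw 4; Sw 3; Sw 2]).
by vm_compute.
Qed.

Lemma ccwK (T : tangle) :
  turn_cw (turn_ccw T) ≈ T.
Proof.
apply: (@movie_sound [:: T] (ECw (ECcw (EBox 0)))
  (EBox 0)
  [:: Ws 0; Ws 1; Ws 3; Ws 2; Ws 1; Do (Zig false) 3 1; Do (Zig false) 0 0]).
by vm_compute.
Qed.

Lemma cwK (T : tangle) :
  turn_ccw (turn_cw T) ≈ T.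
Proof.
apply: (@movie_sound [:: T] (ECcw (ECw (EBox 0)))
  (EBox 0)
  [:: Sw 0; Sw 1; Sw 3; Sw 2; Sw 1; Do (Zig true) 3 0; Do (Zig true) 0 1]).
by vm_compute.
Qed.

Lemma ccw_sigma :
  turn_ccw sigma ≈ sigma_bar.
Proof.
apply: (@movie_sound [::] (ECcw (ECross tc))
  (ECross fc)
  [:: Un (OverCap fc) 0 0; Sw 1; Do (Zig true) 0 1]).
by vm_compute.
Qed.

Lemma ccw_sigma_bar :
  turn_ccw sigma_bar ≈ sigma.
Proof.
apply: (@movie_sound [::] (ECcw (ECross fc))
  (ECross tc)
  [:: Un (OverCap tc) 0 0; Sw 1; Do (Zig true) 0 1]).
by vm_compute.
Qed.

Lemma ccw_rho :
  turn_ccw rho ≈ rho.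
Proof.
apply: (@movie_sound [::] (ECcw (ECross vc))
  (ECross vc)
  [:: Un (OverCap vc) 0 0; Sw 1; Do (Zig true) 0 1]).
by vm_compute.
Qed.

Lemma sigma_vertical_strands :
  hstack sigma vertical_strands ≈ vertical_strands.
Proof.
apply: (@movie_sound [::] (EH (ECross tc) EOne)
  (EOne)
  [:: Do (OverCup tc) 1 0; Do (Kink fc) 0 1; Do (Zig false) 0 0]).
by vm_compute.
Qed.

Lemma rho_vertical_strands :
  hstack rho vertical_strands ≈ vertical_strands.
Proof.
apply: (@movie_sound [::] (EH (ECross vc) EOne)
  (EOne)
  [:: Do (OverCup vc) 1 0; Do (Kink vc) 0 1; Do (Zig false) 0 0]).
by vm_compute.
Qed.

(** A virtual strand is moved across the whole of [T] by [Through vc 0]; straightening the other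
    strands then turns [T] by a quarter turn. *)
Lemma hstack_vstack_rho (T : tangle) :
  hstack rho (vstack T rho) ≈ vstack rho (turn_ccw T).
Proof.
apply: (@movie_sound [:: T] (EH (ECross vc) (EV (EBox 0) (ECross vc)))
  (EV (ECross vc) (ECcw (EBox 0)))
  [:: Do (OverCap vc) 0 0; Un (OverCup vc) 3 1; Un (Bigon vc) 4 2;
      Un (Through vc 0) 2 1; Do (Bigon vc) 1 1; Un (Zig true) 2 3; Sw 0;
      Ws 3; Ws 2; Ws 4; Ws 5; Do (OverCap vc) 3 2; Un (OverCup vc) 4 2;
      Do (Kink vc) 3 2; Ws 0; Do (Zig true) 3 2; Sw 0]).
by vm_compute.
Qed.

Lemma ccw_vertical_strands :
  turn_ccw vertical_strands ≈ horizontal_strands.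
Proof.
apply: (@movie_sound [::] (ECcw EOne)
  (EHone)
  [:: Sw 0]).
by vm_compute.
Qed.

Lemma ccw_horizontal_strands :
  turn_ccw horizontal_strands ≈ vertical_strands.
Proof.
apply: (@movie_sound [::] (ECcw EHone)
  (EOne)
  [:: Sw 1; Sw 2; Do (Zig true) 1 3; Do (Zig true) 0 0]).
by vm_compute.
Qed.

(* The strand of [R] is moved over the whole of T. *)
Lemma rho_over (T : tangle) :
  hstack rho (vstack (vstack rho sigma) T) ≈ vstack (hstack sigma T) tangleR.
Proof.
apply: (@movie_sound [:: T] (EH (ECross vc) (EV (EV (ECross vc) (ECross tc))
  (EBox 0)))
  (EV (EH (ECross tc) (EBox 0)) (EV (ECross fc) (ECross vc)))
  [:: Sw 1; Sw 2; Sw 3; Do (OverCup vc) 4 0; Un (Bigon vc) 5 2;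
      Un (Through vc 0) 3 1; Ws 6; Un (Tri vc vc tc) 2 1;
      Un (OverCap vc) 0 1; Do (Bigon vc) 1 1; Do (Kink vc) 0 2; Sw 3;
      Do (OverCap tc) 0 1; Ws 3; Un (Kink fc) 0 1; Do (Through fc 0) 1 1;
      Ws 3; Un (OverCup tc) 2 0; Ws 1]).
by vm_compute.
Qed.

(** No strand passes the box: the crossings of [R] slide past those of [U] by triangles, among them
    [Tri fc fc vc], an instance of the OC-move. *)
Lemma tangleU_over_commute (T : tangle) :
  hstack tangleU (vstack T tangleR) ≈ vstack (hstack tangleU T) tangleR.
Proof.
apply: (@movie_sound [:: T] (EH (EH (ECross tc) (ECross vc)) (EV (EBox 0) (EV
  (ECross fc) (ECross vc))))
  (EV (EH (EH (ECross tc) (ECross vc)) (EBox 0)) (EV (ECross fc) (ECross vc)))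
  [:: Ws 0; Sw 4; Sw 3; Sw 2; Sw 5; Sw 4; Sw 6; Sw 5; Sw 7;
      Do (OverCup vc) 6 2; Sw 0; Sw 1; Sw 3; Sw 2; Sw 4; Sw 3; Sw 5; Sw 4;
      Sw 6; Do (Zig true) 5 1; Un (Bigon vc) 3 1; Do (Tri vc vc vc) 4 1;
      Ws 6; Un (Tri vc vc fc) 2 1; Sw 6; Do (OverCup tc) 7 0;
      Do (Tri vc vc fc) 5 1; Ws 7; Un (Tri fc fc vc) 3 1; Sw 7;
      Do (Bigon vc) 5 1; Ws 5; Ws 4; Un (OverCup tc) 3 0; Un (Zig true) 3 1;
      Ws 2; Ws 1; Ws 0; Ws 4; Ws 3; Ws 2; Un (OverCup vc) 4 2; Sw 0; Ws 3;
      Ws 5; Ws 4]).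
by vm_compute.
Qed.

Lemma tangleUi_undercross (T : tangle) :
  hstack (hstack rho sigma_bar) T ≈ undercross T.
Proof.
apply: (@movie_sound [:: T] (EH (EH (ECross vc) (ECross fc)) (EBox 0))
  (EUnder (EBox 0))
  [:: Sw 2; Sw 4; Sw 3; Sw 5; Un (OverCap tc) 1 1; Sw 2; Sw 1; Sw 4; Sw 3;
      Do (Zig true) 2 2; Do (OverCup vc) 3 0]).
by vm_compute.
Qed.

(* The strand on the right is moved over the self-crossing of the strand on the
   left. *)
Lemma self_crossing_slide :
  vstack (vstack sigma rho) (hstack (vstack sigma tangleU) tangleL) ≈
    undercross (vstack (vstack sigma rho) (undercross tangleL)).
Proof.
apply: (@movie_sound [::] (EV (EV (ECross tc) (ECross vc)) (EH (EV (ECross tc)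
  (EH (ECross tc) (ECross vc))) (EV (ECross vc) (ECross fc))))
  (EUnder (EV (EV (ECross tc) (ECross vc)) (EUnder (EV (ECross vc) (ECross
    fc)))))
  [:: Sw 5; Sw 7; Sw 6; Sw 5; Sw 4; Sw 8; Sw 7; Sw 9; Un (OverCap vc) 5 1;
      Sw 6; Sw 5; Sw 8; Sw 7; Do (Zig true) 6 2; Do (OverCup tc) 7 0; Sw 3;
      Sw 4; Un (OverCap vc) 2 1; Ws 4; Un (Kink vc) 2 2; Sw 5;
      Un (Tri fc vc vc) 3 1; Do (OverCap fc) 2 1; Un (Bigon vc) 6 2; Ws 7;
      Un (Tri vc vc vc) 4 1; Un (Tri vc vc tc) 3 1; Do (Kink vc) 2 1; Sw 6;
      Un (OverCap vc) 2 1; Un (Bigon vc) 4 0; Sw 1; Sw 0;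
      Do (Tri vc vc vc) 2 0; Ws 0; Un (Tri tc vc vc) 4 0; Ws 8;
      Do (Tri vc vc tc) 6 0; Sw 0; Do (Tri tc vc vc) 1 0;
      Do (OverCap vc) 0 1; Un (Tri vc tc tc) 3 0; Ws 1; Ws 2;
      Do (Bigon vc) 1 0; Un (Tri tc tc tc) 2 0; Ws 1; Un (Zig false) 0 0;
      Sw 1; Sw 2; Sw 0; Un (OverCap fc) 1 1; Un (Bigon vc) 3 3; Ws 4; Sw 2;
      Un (OverCap vc) 1 2; Sw 0; Un (Kink vc) 1 1; Ws 0;
      Do (Tri vc vc fc) 2 1; Sw 0; Un (OverCap tc) 1 1; Sw 5;
      Un (Kink vc) 1 2; Ws 6; Un (Bigon vc) 2 3; Ws 7; Un (OverCap vc) 1 2;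
      Sw 7; Sw 8; Sw 9; Sw 10; Sw 11; Sw 12; Sw 13; Sw 14; Sw 15; Sw 16;
      Sw 17; Un (Bigon vc) 16 2; Do (Tri vc vc vc) 13 3; Ws 15; Sw 12; Sw 11;
      Do (Tri vc vc vc) 13 2; Do (Tri tc vc vc) 12 2; Do (Tri tc vc vc) 10 3;
      Ws 12; Do (Bigon vc) 9 4; Do (Bigon vc) 8 3; Do (Bigon vc) 7 2;
      Un (Bigon vc) 3 4; Sw 8; Sw 9; Sw 10; Sw 11; Sw 7; Sw 8; Sw 9; Sw 10;
      Sw 6; Un (Tri tc vc vc) 4 3; Un (Tri tc vc vc) 6 2;
      Un (Tri vc vc vc) 7 2; Sw 9; Ws 5; Ws 6; Un (Tri vc vc vc) 7 3; Ws 15;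
      Un (Bigon vc) 9 1; Ws 16; Ws 15; Sw 10; Do (Tri vc vc tc) 11 1; Sw 15;
      Sw 9; Un (Tri vc vc vc) 13 1; Sw 16; Sw 15; Ws 9; Do (Bigon vc) 12 1;
      Ws 13; Ws 14; Un (OverCup tc) 15 0; Sw 14; Un (Tri tc vc vc) 12 1;
      Un (Tri vc tc tc) 11 1; Ws 10; Do (Bigon vc) 9 1; Sw 13; Sw 12; Sw 11;
      Do (OverCup tc) 10 2; Do (OverCap vc) 1 2; Do (Tri vc vc tc) 2 3; Ws 4;
      Ws 5; Sw 1; Un (Tri vc vc vc) 6 3; Un (Kink vc) 2 2; Ws 1;
      Do (Tri vc vc tc) 3 2; Un (Tri vc vc vc) 5 2; Do (Bigon vc) 4 2; Sw 5;
      Sw 1; Un (OverCap fc) 2 2; Ws 5; Do (Tri fc vc vc) 3 2;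
      Do (Kink vc) 2 3; Do (OverCap vc) 2 2; Do (Tri fc vc vc) 4 3;
      Do (Tri vc vc vc) 3 3; Sw 2; Un (OverCap vc) 3 2; Sw 4; Sw 5;
      Un (OverCup tc) 8 2; Do (Tri vc vc tc) 6 2; Un (Zig true) 9 3; Ws 8;
      Un (OverCup vc) 9 4; Ws 10; Un (OverCup vc) 9 3; Do (Kink vc) 8 3;
      Do (Zig true) 8 3; Do (OverCup vc) 7 2]).
by vm_compute.
Qed.

(** * Relations between the special tangles *)

#[export] Instance wink_equivalent_Equivalence m n :
  Equivalence (@wink_equivalent m n).
Proof.
split=> [D|D D'|D D' D2]; [exact: rst_refl | exact: rst_sym | exact: rst_trans].
Qed.

Lemma wink_refl T : T ≈ T.
Proof. exact: rst_refl. Qed.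
#[export] Hint Resolve wink_refl : core.

#[export] Instance vstack_Proper :
  Proper (@wink_equivalent 2 2 ==> @wink_equivalent 2 2 ==>
    @wink_equivalent 2 2) vstack.
Proof.
by move=> T1 T1' /weqP e1 T2 T2' /weqP e2; apply/weqP; exact: weq_cat e1 e2.
Qed.

#[export] Instance hstack_Proper :
  Proper (@wink_equivalent 2 2 ==> @wink_equivalent 2 2 ==>
    @wink_equivalent 2 2) hstack.
Proof.
move=> T1 T1' /weqP e1 T2 T2' /weqP e2; apply/weqP.
apply: (@weq_cat 2 4 2 [:: (1, Cap)] [:: (1, Cap)]); first exact: weq_refl.
apply: (weq_cat (weq_right 2 e1)); apply: (weq_cat (weq_shift 2 e2)).
exact: weq_refl.
Qed.

#[export] Instance turn_cw_Proper :
  Proper (@wink_equivalent 2 2 ==> @wink_equivalent 2 2) turn_cw.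
Proof.
move=> T T' /weqP e; apply/weqP.
exact: (@weq_context 2 2 2 2 1 1 [:: (2, Cap)] [:: (0, Cup)] _ _ isT isT e).
Qed.

#[export] Instance turn_ccw_Proper :
  Proper (@wink_equivalent 2 2 ==> @wink_equivalent 2 2) turn_ccw.
Proof.
move=> T T' /weqP e; apply/weqP.
exact: (@weq_context 2 2 2 2 1 1 [:: (0, Cap)] [:: (2, Cup)] _ _ isT isT e).
Qed.

#[export] Instance undercross_Proper :
  Proper (@wink_equivalent 2 2 ==> @wink_equivalent 2 2) undercross.
Proof.
move=> T T' /weqP e; apply/weqP.
exact: (@weq_context 2 2 2 2 2 0 [:: (1, Cap)]
  [:: (1, Cross (Classical true)); (1, Cross Virtual); (0, Cup)] _ _ isT isT e).
Qed.

Local Notation "A ⊚ B" := (vstack A B) (at level 50, left associativity).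
Local Notation "A ⊖ B" := (hstack A B) (at level 50, left associativity).

(** [Ri] and [Li] are the inverses of [R] and [L] for ⊚, and [Ui] that of [U] for ⊖; see [RRi],
    [LLi] and [UiU]. *)
Definition Ri : tangle := rho ⊚ sigma.
Definition Li : tangle := sigma ⊚ rho.
Definition Ui : tangle := rho ⊖ sigma_bar.
Local Notation R := tangleR.
Local Notation L := tangleL.
Local Notation U := tangleU.
Local Notation D := tangleD.
Local Notation "1v" := vertical_strands.
Local Notation "1h" := horizontal_strands.

(** Vertical stacking concatenates words, hence an equality, oriented to the left; [hstackA] holds
    up to isotopy only and is oriented to the right. *)
Lemma vstackA A B C : A ⊚ (B ⊚ C) = A ⊚ B ⊚ C.
Proof. by apply: diagram_eq; rewrite /= catA. Qed.

Lemma vstack1 T : 1v ⊚ T = T.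
Proof. exact: diagram_eq. Qed.

Lemma vstackr1 T : T ⊚ 1v = T.
Proof. by apply: diagram_eq; rewrite /= cats0. Qed.

Lemma elementaryV c : elementary c ⊚ elementary (turn c) ≈ 1v.
Proof.
apply/weqP; have := weq_bigon (turn c) 0; rewrite turnK; exact.
Qed.

Lemma rho_rho : rho ⊚ rho ≈ 1v.
Proof. exact: (elementaryV Virtual). Qed.
Lemma sigma_sigma_bar : sigma ⊚ sigma_bar ≈ 1v.
Proof. exact: (elementaryV (Classical true)). Qed.
Lemma sigma_bar_sigma : sigma_bar ⊚ sigma ≈ 1v.
Proof. exact: (elementaryV (Classical false)). Qed.

Lemma hstack_rho_rho : rho ⊖ rho ≈ 1h.
Proof.
by have := ccw_vstack rho rho; rewrite rho_rho ccw_vertical_strands ccw_rho =>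
  <-.
Qed.
Lemma hstack_sigma_bar_sigma : sigma_bar ⊖ sigma ≈ 1h.
Proof.
have := ccw_vstack sigma sigma_bar.
by rewrite sigma_sigma_bar ccw_vertical_strands ccw_sigma ccw_sigma_bar => <-.
Qed.

Lemma RiR : Ri ⊚ R ≈ 1v.
Proof. by rewrite /Ri vstackA -(vstackA rho) sigma_sigma_bar vstackr1 rho_rho.
  Qed.
Lemma RRi : R ⊚ Ri ≈ 1v.
Proof.
by rewrite /Ri vstackA -(vstackA sigma_bar) rho_rho vstackr1 sigma_bar_sigma.
Qed.
Lemma LLi : L ⊚ Li ≈ 1v.
Proof. by rewrite /Li vstackA -(vstackA rho) sigma_bar_sigma vstackr1 rho_rho.
  Qed.
Lemma UiU : Ui ⊖ U ≈ 1h.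
Proof.
by rewrite /Ui -hstackA (hstackA rho) hstack_sigma_bar_sigma hstackr1
  hstack_rho_rho.
Qed.

(** The words of [L] and [Li] are [wink_K false] and [wink_K true], so this lemma and the next are
    the two wink-moves themselves. *)
Lemma wink_L c : elementary (Classical c) ⊖ L ≈ L.
Proof.
apply/weqP; apply: weq_move => //; right.
exact: (Wink c false).
Qed.
Lemma wink_Li c : elementary (Classical c) ⊖ Li ≈ Li.
Proof.
apply/weqP; apply: weq_move => //; right.
exact: (Wink c true).
Qed.

(** * Symmetries: the half turn and conjugation by [rho] *)

Definition half_turn (T : tangle) : tangle := turn_ccw (turn_ccw T).
#[export] Instance half_turn_Proper :
  Proper (@wink_equivalent 2 2 ==> @wink_equivalent 2 2) half_turn.
Proof. by move=> T T' e; rewrite /half_turn e. Qed.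

Lemma half_turn_vstack A B : half_turn (A ⊚ B) ≈ half_turn B ⊚ half_turn A.
Proof. by rewrite /half_turn ccw_vstack ccw_hstack. Qed.
Lemma half_turn_hstack A B : half_turn (A ⊖ B) ≈ half_turn B ⊖ half_turn A.
Proof. by rewrite /half_turn ccw_hstack ccw_vstack. Qed.
Lemma ccw_inj A B : turn_ccw A ≈ turn_ccw B -> A ≈ B.
Proof. by move=> e; rewrite -(ccwK A) e ccwK. Qed.
Lemma half_turn_inj A B : half_turn A ≈ half_turn B -> A ≈ B.
Proof. by move=> e; apply: ccw_inj; apply: ccw_inj. Qed.
Lemma half_turn_rho : half_turn rho ≈ rho.
Proof. by rewrite /half_turn !ccw_rho. Qed.
Lemma ccwR : turn_ccw R ≈ U.
Proof. by rewrite /R ccw_vstack ccw_sigma_bar ccw_rho. Qed.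
Lemma ccwL : turn_ccw L ≈ D.
Proof. by rewrite ccw_vstack ccw_sigma_bar ccw_rho. Qed.
Lemma ccwU : turn_ccw U ≈ L.
Proof. by rewrite ccw_hstack ccw_sigma ccw_rho. Qed.
Lemma ccwD : turn_ccw D ≈ R.
Proof. by rewrite ccw_hstack ccw_sigma ccw_rho. Qed.
Lemma half_turnR : half_turn R ≈ L. Proof. by rewrite /half_turn ccwR ccwU. Qed.
Lemma half_turnL : half_turn L ≈ R. Proof. by rewrite /half_turn ccwL ccwD. Qed.
Lemma half_turnRi : half_turn Ri ≈ Li.
Proof.
by rewrite /half_turn ccw_vstack ccw_hstack !ccw_sigma !ccw_rho ccw_sigma_bar.
Qed.
Lemma half_turnLi : half_turn Li ≈ Ri.
Proof.
by rewrite /half_turn ccw_vstack ccw_hstack !ccw_sigma !ccw_rho ccw_sigma_bar.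
Qed.

Lemma vstack_hstack_rho T : (T ⊖ rho) ⊚ rho ≈ rho ⊖ turn_ccw T.
Proof.
have := hstack_vstack_rho (turn_cw T) => /turn_ccw_Proper.
by rewrite ccw_hstack !ccw_vstack !ccw_rho cwK.
Qed.

(** An involution that preserves ⊖, reverses ⊚ ([flip_vstack]), fixes [R] and [L] and exchanges [U]
    and [D]. It yields the relations for [D] from those for [U], and the action at the bottom of a
    product from that at the top. *)
Definition flip (T : tangle) : tangle := rho ⊖ T ⊖ rho.
#[export] Instance flip_Proper :
  Proper (@wink_equivalent 2 2 ==> @wink_equivalent 2 2) flip.
Proof. by move=> T T' e; rewrite /flip e. Qed.

(** After [rho ⊚ rho] is inserted below, one of these crossings is absorbed by [vstack_hstack_rho]
    and then [hstack_vstack_rho], each of which adds a quarter turn. *)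
Lemma flipE T : flip T ≈ rho ⊚ half_turn T ⊚ rho.
Proof.
rewrite -[flip T]vstackr1 -rho_rho vstackA vstack_hstack_rho ccw_hstack ccw_rho.
by rewrite hstack_vstack_rho.
Qed.
Lemma flip_vstack A B : flip (A ⊚ B) ≈ flip B ⊚ flip A.
Proof.
by rewrite !flipE half_turn_vstack !vstackA -(vstackA (rho ⊚ _) rho) rho_rho
  vstackr1.
Qed.
Lemma flip_hstack A B : flip (A ⊖ B) ≈ flip A ⊖ flip B.
Proof.
by rewrite /flip -!hstackA (hstackA _ rho rho) hstack_rho_rho hstackr1.
Qed.
Lemma flipR : flip R ≈ R.
Proof. by rewrite flipE half_turnR /L vstackA rho_rho vstack1. Qed.
Lemma flipL : flip L ≈ L.
Proof. by rewrite flipE half_turnL -!vstackA rho_rho vstackr1. Qed.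
Lemma flipRi : flip Ri ≈ Ri.
Proof. by rewrite flipE half_turnRi /Li -!vstackA rho_rho vstackr1. Qed.
Lemma flipLi : flip Li ≈ Li.
Proof. by rewrite flipE half_turnLi /Ri vstackA rho_rho vstack1. Qed.
Lemma flipU : flip U ≈ D.
Proof. by rewrite /flip /U -hstackA hstackA hstack_rho_rho hstackr1. Qed.
Lemma hrhoK T : rho ⊖ (rho ⊖ T) ≈ T.
Proof. by rewrite -hstackA hstack_rho_rho hstack1. Qed.
Lemma hrhoKr T : T ⊖ rho ⊖ rho ≈ T.
Proof. by rewrite hstackA hstack_rho_rho hstackr1. Qed.
Lemma flipK T : flip (flip T) ≈ T.
Proof. by rewrite /flip -!hstackA hrhoKr hstack_rho_rho hstack1. Qed.
Lemma hsigmaE T : sigma ⊖ T ≈ U ⊖ (rho ⊖ T).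
Proof. by rewrite /U hstackA hrhoK. Qed.

Lemma vstackRK T : T ⊚ R ⊚ Ri ≈ T.
Proof. by rewrite -vstackA RRi vstackr1. Qed.

Lemma vstackR_inj A B : A ⊚ R ≈ B ⊚ R -> A ≈ B.
Proof. by move=> e; rewrite -(vstackRK A) e vstackRK. Qed.

(** * Horizontal stacking of [rho], [U] and [D] on vertical products *)

Lemma hU_vstackR T : U ⊖ (T ⊚ R) ≈ U ⊖ T ⊚ R.
Proof. exact: tangleU_over_commute. Qed.

(** This strips a factor [Ri] from the top of a product standing to the right of [rho];
    [hrho_vstack_Ri], its image under [flip], strips one from the bottom. *)
Lemma hrho_Ri_vstack T : rho ⊖ (Ri ⊚ T) ≈ U ⊖ (rho ⊖ T) ⊚ R.
Proof. by rewrite -hsigmaE -rho_over. Qed.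

Lemma hD_Rvstack T : D ⊖ (R ⊚ T) ≈ R ⊚ (D ⊖ T).
Proof.
by have := hU_vstackR (flip T) => /flip_Proper;
  rewrite flip_hstack 2!flip_vstack flipU flipR flip_hstack flipU flipK.
Qed.

Lemma flip_hrho T : flip (rho ⊖ T) ≈ rho ⊖ flip T.
Proof. by rewrite /flip -!hstackA. Qed.

Lemma hrho_vstack_Ri T : rho ⊖ (T ⊚ Ri) ≈ R ⊚ (D ⊖ (rho ⊖ T)).
Proof.
have := hrho_Ri_vstack (flip T) => /flip_Proper.
by rewrite flip_hrho 2!flip_vstack flipRi flipK flipR flip_hstack flipU
  flip_hrho flipK.
Qed.

(** The source of the relations below: both sides are evaluated for a suitable product [T]. *)
Lemma half_turn_hrho T : half_turn (rho ⊖ T) ≈ rho ⊖ flip (half_turn T).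
Proof.
by rewrite half_turn_hstack half_turn_rho /flip -!hstackA hstack_rho_rho
  hstack1.
Qed.

Lemma hU1 : U ⊖ 1v ≈ 1v.
Proof. by rewrite -{2}sigma_vertical_strands hsigmaE rho_vertical_strands. Qed.

Lemma hrhoRi : rho ⊖ Ri ≈ R.
Proof.
by rewrite -[Ri]vstackr1 hrho_Ri_vstack rho_vertical_strands hU1 vstack1.
Qed.
Lemma hrhoR : rho ⊖ R ≈ Ri.
Proof. by rewrite -hrhoRi hrhoK. Qed.
Lemma hU_R : U ⊖ R ≈ R.
Proof. by rewrite -[R]vstack1 hU_vstackR hU1. Qed.
Lemma hrhoRiRi : rho ⊖ (Ri ⊚ Ri) ≈ R ⊚ R.
Proof. by rewrite hrho_Ri_vstack hrhoRi hU_R. Qed.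
Lemma hrhoRR : rho ⊖ (R ⊚ R) ≈ Ri ⊚ Ri.
Proof. by rewrite -hrhoRiRi hrhoK. Qed.
Lemma hrhoL : rho ⊖ L ≈ Li.
Proof.
by have := half_turn_hrho R; rewrite hrhoR half_turnRi half_turnR flipL => <-.
Qed.
Lemma hrhoLi : rho ⊖ Li ≈ L.
Proof. by rewrite -hrhoL hrhoK. Qed.
Lemma hrhoLL : rho ⊖ (L ⊚ L) ≈ Li ⊚ Li.
Proof.
by have := half_turn_hrho (R ⊚ R);
  rewrite hrhoRR 2!half_turn_vstack half_turnRi half_turnR !(flip_vstack L L)
    flipL => <-.
Qed.
Lemma hrhoLiLi : rho ⊖ (Li ⊚ Li) ≈ L ⊚ L.
Proof. by rewrite -hrhoLL hrhoK. Qed.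

(** As [Li] is [rho ⊖ L], the left side is [sigma ⊖ L], to which the wink-move applies. *)
Lemma hU_Li : U ⊖ Li ≈ L.
Proof. by rewrite -hrhoL -hsigmaE; exact: wink_L. Qed.
Lemma hU_L : U ⊖ L ≈ Li.
Proof. by rewrite -hrhoLi -hsigmaE; exact: wink_Li. Qed.
Lemma hD_Li : D ⊖ Li ≈ L.
Proof. by rewrite -flipU -flipLi -flip_hstack hU_Li flipL. Qed.
Lemma hD_L : D ⊖ L ≈ Li.
Proof. by rewrite -flipU -flipL -flip_hstack hU_L flipLi. Qed.

Lemma hrhoLiRi : rho ⊖ (Li ⊚ Ri) ≈ R ⊚ Li.
Proof. by rewrite hrho_vstack_Ri hrhoLi hD_L. Qed.
(** Stripping [Ri] turns [rho ⊖ (Ri ⊚ Li)] into [Li ⊚ R], with half turn [L ⊚ Ri]. By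
    [half_turn_hrho] that half turn is also [rho ⊖ (Li ⊚ Ri)]. *)
Lemma L_Ri : L ⊚ Ri ≈ R ⊚ Li.
Proof.
have := half_turn_hrho (Ri ⊚ Li).
rewrite hrho_Ri_vstack hrhoLi hU_L 2!half_turn_vstack half_turnRi half_turnLi
  half_turnR (flip_vstack Ri Li) flipRi flipLi.
by rewrite hrhoLiRi.
Qed.
Lemma R_L : R ⊚ L ≈ Li ⊚ Ri.
Proof.
have := half_turn_hrho (L ⊚ Ri).
rewrite hrho_vstack_Ri hrhoL hD_Li 2!half_turn_vstack half_turnRi half_turnL
  half_turnR (flip_vstack Li R) flipLi flipR.
by rewrite -hrhoLiRi hrhoK.
Qed.
Lemma hU_LL : U ⊖ (L ⊚ L) ≈ Li ⊚ Li.
Proof.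
(* The product is chosen so that stripping [Ri] exposes [(U ⊖ (L ⊚ L)) ⊚ R]; the other side becomes
   [R ⊚ (R ⊚ L)]. *)
have := half_turn_hrho (Ri ⊚ (Li ⊚ Li)).
rewrite hrho_Ri_vstack hrhoLiLi !(half_turn_vstack Ri) !(half_turn_vstack Li)
  half_turnRi half_turnLi (flip_vstack (Ri ⊚ Ri)) (flip_vstack Ri Ri) flipLi
    flipRi.
rewrite vstackA (hrho_vstack_Ri (Li ⊚ Ri)) hrhoLiRi hD_Rvstack hD_Li => e.
apply: vstackR_inj; apply: half_turn_inj; rewrite {}e.
by rewrite (half_turn_vstack (Li ⊚ Li)) half_turnR (half_turn_vstack Li)
  half_turnLi (vstackA L) L_Ri -(vstackA R Li) R_L.
Qed.

Lemma undercross_hU T : undercross (U ⊖ T) ≈ T.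
Proof. by rewrite -tangleUi_undercross -hstackA UiU hstack1. Qed.

Lemma wink_U : sigma ⊚ U ≈ U.
Proof.
apply: ccw_inj; rewrite ccw_vstack ccw_sigma ccwU; exact: (wink_L false).
Qed.

(* The wink-move is applied to the configuration [U], whose two strands both lie
   on the left strand of [U ⊖ L]. *)
Lemma LL_LiLi : L ⊚ L ≈ Li ⊚ Li.
Proof.
have := self_crossing_slide; rewrite -/Li.
have uL : undercross L ≈ Li by rewrite -(undercross_hU Li) hU_Li.
(* The left side of the slide is [Li ⊚ Li]. The right side is [undercross (Li ⊚ Li)], hence
   [undercross (U ⊖ (L ⊚ L))], hence [L ⊚ L]. *)
by rewrite wink_U hU_L uL -hU_LL undercross_hU hU_LL => <-.
Qed.

(** * Normal forms *)

Lemma vpowerS T n : vpower T n.+1 = T ⊚ vpower T n.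
Proof. by case: n => [|n] //; rewrite /vpower /= vstackr1. Qed.

Lemma vpowerSr T n : vpower T n.+1 = vpower T n ⊚ T.
Proof.
by elim: n => [|n IH]; rewrite ?vstack1 // vpowerS {1}IH vstackA -vpowerS.
Qed.

Lemma hpowerS T n : hpower T n.+1 ≈ T ⊖ hpower T n.
Proof. by case: n => [|n] //; rewrite /hpower /= hstackr1. Qed.

#[export] Instance vpower_Proper n :
  Proper (@wink_equivalent 2 2 ==> @wink_equivalent 2 2) (fun T => vpower T n).
Proof. by move=> T T' e; elim: n => // n IH; rewrite !vpowerS IH e. Qed.
#[export] Instance hpower_Proper n :
  Proper (@wink_equivalent 2 2 ==> @wink_equivalent 2 2) (fun T => hpower T n).
Proof. by move=> T T' e; elim: n => // n IH; rewrite !hpowerS IH e. Qed.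

Lemma ccw_vpower T n : turn_ccw (vpower T n) ≈ hpower (turn_ccw T) n.
Proof.
elim: n => [|n IH]; first exact: ccw_vertical_strands.
by rewrite vpowerS ccw_vstack IH hpowerS.
Qed.

Lemma ccw_hpower T n : turn_ccw (hpower T n) ≈ vpower (turn_ccw T) n.
Proof.
elim: n => [|n IH]; first exact: ccw_horizontal_strands.
by rewrite hpowerS ccw_hstack IH vpowerSr.
Qed.

Lemma ccw_tangleV u v : turn_ccw (tangleV u v) ≈ tangleH u v.
Proof.
by rewrite ccw_vstack !ccw_vpower (hpower_Proper u ccwR) (hpower_Proper v ccwL).
Qed.

Lemma ccw_tangleH u v : turn_ccw (tangleH u v) ≈ tangleV v u.
Proof.
by rewrite ccw_hstack !ccw_hpower (vpower_Proper u ccwU) (vpower_Proper v ccwD).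
Qed.

Lemma RR_RiRi : R ⊚ R ≈ Ri ⊚ Ri.
Proof.
by have := LL_LiLi => /half_turn_Proper;
  rewrite (half_turn_vstack L L) (half_turn_vstack Li Li) half_turnL
    half_turnLi.
Qed.

Lemma vpower4 T Ti : T ⊚ Ti ≈ 1v -> T ⊚ T ≈ Ti ⊚ Ti ->
  [/\ vpower T 2 ≈ Ti ⊚ Ti, vpower T 3 ≈ Ti & vpower T 4 ≈ 1v].
Proof.
move=> TTi TT; have T3 : vpower T 3 ≈ Ti.
  by rewrite /vpower /= TT vstackA TTi vstack1.
by split=> //; rewrite vpowerS T3.
Qed.

Lemma vpower_mod T n : vpower T 4 ≈ 1v -> vpower T n ≈ vpower T (n %% 4).
Proof.
move=> T4; rewrite {1}(divn_eq n 4) addnC; elim: (n %/ 4) => [|k IH].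
  by rewrite addn0.
rewrite -IH mulSn addnCA; set m := n %% 4 + k * 4.
by rewrite add4n !vpowerS !vstackA; move: T4;
  rewrite /vpower /= !vstackA => ->; rewrite vstack1.
Qed.

(** * Type V is a group under ⊚, stable under stacking [U], [D] or [rho] *)

Definition inV (T : tangle) : Prop :=
  exists u v, [/\ u < 4, v < 4 & T ≈ tangleV u v].

#[export] Instance inV_Proper : Proper (@wink_equivalent 2 2 ==> iff) inV.
Proof.
by move=> T T' e; split=> -[u [v [u4 v4 TV]]]; exists u, v; split=> //;
  rewrite -TV e.
Qed.

Lemma inV_tangleV u v : inV (tangleV u v).
Proof.
exists (u %% 4), (v %% 4); rewrite !ltn_pmod //; split=> //.
have [_ _ R4] := vpower4 RRi RR_RiRi; have [_ _ L4] := vpower4 LLi LL_LiLi.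
by rewrite /tangleV (vpower_mod u R4) (vpower_mod v L4).
Qed.

Lemma vpowerR3 : vpower R 3 ≈ Ri.
Proof. by have [] := vpower4 RRi RR_RiRi. Qed.
Lemma vpowerL3 : vpower L 3 ≈ Li.
Proof. by have [] := vpower4 LLi LL_LiLi. Qed.

Lemma inV_mulL T : inV T -> inV (T ⊚ L).
Proof.
case=> u [v [_ _ ->]]; have := inV_tangleV u v.+1.
by rewrite /tangleV vpowerSr vstackA.
Qed.

Lemma vpowerD T m n : vpower T (m + n) = vpower T m ⊚ vpower T n.
Proof. by elim: m => [|m IH]; rewrite ?vstack1 // addSn !vpowerS IH vstackA.
  Qed.

Lemma L_R : L ⊚ R ≈ Ri ⊚ Li.
Proof.
by have := R_L => /flip_Proper;
  rewrite (flip_vstack R) (flip_vstack Li) flipR flipL flipRi flipLi.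
Qed.
Lemma Li_R : Li ⊚ R ≈ Ri ⊚ L.
Proof.
by have := L_Ri => /flip_Proper;
  rewrite (flip_vstack L) (flip_vstack R) flipR flipL flipRi flipLi => <-.
Qed.

(** [R] is carried to the left through [L^v]; for [v] equal to 1, 2, 3 what remains on the right is
    [L^3], [L^2], [L]. *)
Lemma inV_mulR T : inV T -> inV (T ⊚ R).
Proof.
case=> u [v [_ v4 ->]]; rewrite /tangleV -vstackA.
case: v v4 => [|[|[|[|//]]]] _.
- by rewrite vstack1 -vpowerSr -[_ u.+1]vstackr1; exact: (inV_tangleV u.+1 0).
- rewrite [vpower L 1]/(L) L_R -vpowerR3 -vpowerL3 vstackA -vpowerD;
    exact: inV_tangleV.
- rewrite [vpower L 2]/(L ⊚ L) -(vstackA L) L_R (vstackA L) L_Ri -(vstackA R)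
    -LL_LiLi vstackA -vpowerSr.
  exact: (inV_tangleV u.+1 2).
- by rewrite vpowerL3 Li_R -vpowerR3 vstackA -vpowerD;
    exact: (inV_tangleV (u + 3) 1).
Qed.

Lemma inV_mul A B : inV A -> inV B -> inV (A ⊚ B).
Proof.
move=> VA [u [v [_ _ ->]]]; rewrite /tangleV vstackA.
elim: v => [|v IH]; last by rewrite vpowerSr vstackA; exact: inV_mulL.
rewrite vstackr1; elim: u => [|u IH]; first by rewrite vstackr1.
by rewrite vpowerSr vstackA; exact: inV_mulR.
Qed.

Lemma inV_one : inV 1v.
Proof. by have := inV_tangleV 0 0; rewrite /tangleV vstackr1. Qed.
Lemma inV_vpowerR u : inV (vpower R u).
Proof. by have := inV_tangleV u 0; rewrite /tangleV vstackr1. Qed.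
Lemma inV_vpowerL v : inV (vpower L v).
Proof. by have := inV_tangleV 0 v; rewrite /tangleV vstack1. Qed.

Lemma flip1 : flip 1v ≈ 1v.
Proof.
by rewrite flipE /half_turn ccw_vertical_strands ccw_horizontal_strands
  vstackr1 rho_rho.
Qed.

Lemma flip_vpower T n : flip (vpower T n) ≈ vpower (flip T) n.
Proof.
elim: n => [|n IH]; first exact: flip1.
by rewrite vpowerS flip_vstack IH vpowerSr.
Qed.

Lemma inV_flip T : inV T -> inV (flip T).
Proof.
case=> u [v [_ _ ->]]; rewrite /tangleV flip_vstack !flip_vpower.
rewrite (vpower_Proper _ flipR) (vpower_Proper _ flipL).
exact: inV_mul (inV_vpowerL v) (inV_vpowerR u).
Qed.

(** An automorphism for ⊚ that exchanges [R] and [L], and the counterpart of [flip] under a quarter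
    turn. *)
Definition vswap (T : tangle) : tangle := rho ⊚ T ⊚ rho.
#[export] Instance vswap_Proper :
  Proper (@wink_equivalent 2 2 ==> @wink_equivalent 2 2) vswap.
Proof. by move=> T T' e; rewrite /vswap e. Qed.

Lemma vswapK T : vswap (vswap T) ≈ T.
Proof. by rewrite /vswap !vstackA rho_rho vstack1 -vstackA rho_rho vstackr1.
  Qed.
Lemma vswapV A B : vswap (A ⊚ B) ≈ vswap A ⊚ vswap B.
Proof. by rewrite /vswap !vstackA -(vstackA (rho ⊚ A) rho) rho_rho vstackr1.
  Qed.
Lemma vswap_vpower T n : vswap (vpower T n) ≈ vpower (vswap T) n.
Proof.
elim: n => [|n IH]; first by rewrite /vswap vstackr1 rho_rho.
by rewrite !vpowerS vswapV IH.
Qed.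
Lemma vswapR : vswap R ≈ L.
Proof. by rewrite /vswap /R vstackA -vstackA rho_rho vstackr1. Qed.
Lemma vswapL : vswap L ≈ R.
Proof. by rewrite -vswapR vswapK. Qed.

Lemma inV_vswap T : inV T -> inV (vswap T).
Proof.
case=> u [v [_ _ ->]]; rewrite /tangleV vswapV !vswap_vpower.
rewrite (vpower_Proper _ vswapR) (vpower_Proper _ vswapL).
exact: inV_mul (inV_vpowerL u) (inV_vpowerR v).
Qed.

(** The normal form with [R] at the bottom, where [hU_vstackR] can pull it out of [U ⊖ T]; it is the
    usual normal form of [vswap T], swapped back. *)
Lemma inV_LR T : inV T -> exists u v, v < 4 /\ T ≈ vpower L v ⊚ vpower R u.
Proof.
case/inV_vswap=> u [v [u4 _ e]]; exists v, u; split=> //.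
rewrite -(vswapK T) e /tangleV vswapV !vswap_vpower.
by rewrite (vpower_Proper _ vswapR) (vpower_Proper _ vswapL).
Qed.

Lemma inV_Li : inV Li. Proof. by rewrite -vpowerL3; exact: inV_vpowerL. Qed.

Lemma inV_hU T : inV T -> inV (U ⊖ T).
Proof.
case/inV_LR=> u [v [v4 ->]].
have -> : U ⊖ (vpower L v ⊚ vpower R u) ≈ U ⊖ vpower L v ⊚ vpower R u.
  elim: u => [|u IH]; first by rewrite !vstackr1.
  by rewrite vpowerSr (vstackA (vpower L v)) (vstackA (U ⊖ _)) hU_vstackR IH.
apply: inV_mul (inV_vpowerR u).
case: v v4 => [|[|[|[|//]]]] _.
- by rewrite hU1; exact: inV_one.
- by rewrite [vpower L 1]/(L) hU_L; exact: inV_Li.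
- by rewrite [vpower L 2]/(L ⊚ L) hU_LL; exact: inV_mul inV_Li inV_Li.
- by rewrite vpowerL3 hU_Li; exact: (inV_vpowerL 1).
Qed.

Lemma inV_hrho T : inV T -> inV (rho ⊖ T).
Proof.
case=> u [v [u4 v4 ->]].
have V0 : inV (rho ⊖ vpower L v).
  case: v v4 => [|[|[|[|//]]]] _.
  - by rewrite rho_vertical_strands; exact: inV_one.
  - by rewrite [vpower L 1]/(L) hrhoL; exact: inV_Li.
  - by rewrite [vpower L 2]/(L ⊚ L) hrhoLL; exact: inV_mul inV_Li inV_Li.
  - by rewrite vpowerL3 hrhoLi; exact: (inV_vpowerL 1).
have VS X : inV (rho ⊖ X) -> inV (rho ⊖ (Ri ⊚ X)).
  by move=> VX; rewrite hrho_Ri_vstack; apply: inV_mulR; apply: inV_hU.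
rewrite /tangleV; case: u u4 => [|[|[|[|//]]]] _.
- by rewrite vstack1.
(* Only [Ri] can be stripped at the top, so [R^u] is replaced by the power [4 - u] of [Ri]. *)
- have -> : vpower R 1 ≈ Ri ⊚ (Ri ⊚ Ri) by rewrite -RR_RiRi (vstackA Ri) RiR
    vstack1.
  by rewrite -(vstackA Ri (Ri ⊚ Ri)) -(vstackA Ri Ri); do 3!apply: (VS).
- have -> : vpower R 2 ≈ Ri ⊚ Ri by exact: RR_RiRi.
  by rewrite -(vstackA Ri Ri); do 2!apply: (VS).
- by rewrite vpowerR3; apply: VS.
Qed.

Lemma inV_hD T : inV T -> inV (D ⊖ T).
Proof.
move=> VT; have -> : D ⊖ T ≈ flip (U ⊖ flip T) by rewrite flip_hstack flipU
  flipK.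
exact/inV_flip/inV_hU/inV_flip.
Qed.

Lemma half_turn_tangleV u v : half_turn (tangleV u v) ≈ tangleV v u.
Proof. by rewrite /half_turn ccw_tangleV ccw_tangleH. Qed.

Lemma inV_half_turn T : inV (half_turn T) <-> inV T.
Proof.
split=> -[u [v [_ _ e]]]; last by rewrite e half_turn_tangleV;
  exact: inV_tangleV.
have -> : T ≈ tangleV v u by apply: half_turn_inj; rewrite e half_turn_tangleV.
exact: inV_tangleV.
Qed.

(* A tangle of type H is the quarter turn of one of type V. *)
Definition inH (T : tangle) : Prop := exists2 V, inV V & T ≈ turn_ccw V.
(** As [rho ⊖ rho] is trivial, this says that [T] is a tangle of type H followed by [rho]. *)
Definition inX (T : tangle) : Prop := inH (T ⊖ rho).

#[export] Instance inH_Proper : Proper (@wink_equivalent 2 2 ==> iff) inH.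
Proof. by move=> T T' e; split=> -[V VV TV]; exists V => //; rewrite -TV e. Qed.
#[export] Instance inX_Proper : Proper (@wink_equivalent 2 2 ==> iff) inX.
Proof. by move=> T T' e; rewrite /inX e. Qed.

Lemma inHP T : inH T -> exists u v, [/\ u < 4, v < 4 & T ≈ tangleH u v].
Proof.
by case=> V [u [v [u4 v4 e]]] TV; exists u, v; split=> //;
  rewrite TV e ccw_tangleV.
Qed.

Lemma inXP T : inX T -> exists u v, [/\ u < 4, v < 4 & T ≈ tangleX u v].
Proof.
case/inHP=> u [v [u4 v4 e]]; exists u, v; split=> //.
by rewrite -(hrhoKr T) e.
Qed.

Lemma inH_flip T : inH T -> inH (flip T).
Proof.
case=> V VV ->; exists (vswap V); first exact: inV_vswap.
by rewrite /flip /vswap !ccw_vstack ccw_rho hstackA.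
Qed.

Lemma inH_hrho T : inX T -> inH (rho ⊖ T).
Proof. by move/inH_flip; rewrite /flip hstackA hrhoKr. Qed.

Lemma inX_hrho T : inH T -> inX (rho ⊖ T).
Proof. exact: inH_flip. Qed.

Lemma hstackHH A B : inH A -> inH B -> inH (A ⊖ B).
Proof.
move=> [V VV ->] [W VW ->]; exists (V ⊚ W); first exact: inV_mul.
by rewrite ccw_vstack.
Qed.

Lemma hstackHX A B : inH A -> inX B -> inX (A ⊖ B).
Proof. by rewrite /inX hstackA; exact: hstackHH. Qed.

(** A [rho] passed between the factors makes an X on either side an H, so that every case with an X
    reduces to one without. *)
Lemma hstack_insert_rho A B : A ⊖ B ≈ (A ⊖ rho) ⊖ (rho ⊖ B).
Proof. by rewrite hstackA hrhoK. Qed.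

Lemma hstackXH A B : inX A -> inH B -> inX (A ⊖ B).
Proof.
by move=> XA HB; rewrite hstack_insert_rho; apply: hstackHX XA (inX_hrho HB).
Qed.

Lemma hstackXX A B : inX A -> inX B -> inH (A ⊖ B).
Proof.
by move=> XA XB; rewrite hstack_insert_rho; apply: hstackHH XA (inH_hrho XB).
Qed.

Lemma hstackHV A B : inH A -> inV B -> inV (A ⊖ B).
Proof.
case/inHP=> u [v [_ _ ->]] VB; rewrite /tangleH hstackA.
have VvB : inV (hpower D v ⊖ B).
  elim: v => [|v IH]; first by rewrite hstack1.
  by rewrite hpowerS hstackA; exact: inV_hD.
elim: u => [|u IH]; first by rewrite hstack1.
by rewrite hpowerS hstackA; exact: inV_hU.
Qed.

Lemma hstackXV A B : inX A -> inV B -> inV (A ⊖ B).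
Proof.
by move=> XA VB; rewrite hstack_insert_rho; apply: hstackHV XA (inV_hrho VB).
Qed.

Lemma inH_half_turn T : inH T -> inH (half_turn T).
Proof. by case=> V VV ->; exists (half_turn V) => //; exact/inV_half_turn. Qed.

Lemma hstackVH A B : inV A -> inH B -> inV (A ⊖ B).
Proof.
move=> VA HB; apply/inV_half_turn; rewrite half_turn_hstack.
by apply: hstackHV (inH_half_turn HB) _; exact/inV_half_turn.
Qed.

Lemma inV_rho_r T : inV T -> inV (T ⊖ rho).
Proof.
move=> VT; have -> : T ⊖ rho ≈ rho ⊖ flip T by rewrite /flip hstackA hrhoK.
exact/inV_hrho/inV_flip.
Qed.

Lemma hstackVX A B : inV A -> inX B -> inV (A ⊖ B).
Proof.
by move=> VA XB; rewrite hstack_insert_rho;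
  apply: hstackVH (inV_rho_r VA) (inH_hrho XB).
Qed.

Lemma inX_vstack_rho V : inV V -> inX (V ⊚ rho).
Proof.
move=> VV; rewrite -(hrhoKr V) vstack_hstack_rho.
by apply: inX_hrho; exists (V ⊖ rho) => //; exact: inV_rho_r.
Qed.

Lemma inX_rho_vstack V : inV V -> inX (rho ⊚ V).
Proof.
move=> VV; have -> : rho ⊚ V ≈ vswap V ⊚ rho by rewrite /vswap -vstackA rho_rho
  vstackr1.
exact/inX_vstack_rho/inV_vswap.
Qed.

Lemma inH_ccw T : inH (turn_ccw T) <-> inV T.
Proof.
split=> [[V VV /ccw_inj ->] //|VT]; by exists T.
Qed.

Lemma inV_ccw T : inV (turn_ccw T) <-> inH T.
Proof.
split=> [VT|[V VV ->]]; last exact/inV_half_turn.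
exists (turn_cw T); last by rewrite cwK.
apply/inV_half_turn; by rewrite /half_turn cwK.
Qed.

(** A quarter turn preserves X and exchanges H and V ([inH_ccw], [inV_ccw]), so the table for ⊖
    yields the one for ⊚. *)
Lemma inX_ccw T : inX (turn_ccw T) <-> inX T.
Proof.
split=> [[V VV e]|[V VV e]].
  have -> : T ≈ V ⊚ rho.
    by apply: ccw_inj; rewrite ccw_vstack ccw_rho -e hrhoKr.
  exact: inX_vstack_rho.
rewrite -(hrhoKr T) e ccw_hstack ccw_rho.
by apply: inX_rho_vstack; exact/inV_half_turn.
Qed.

Lemma inX_sigma : inX sigma.
Proof. by exists R; [exact: (inV_vpowerR 1) | rewrite ccwR]. Qed.
Lemma inX_sigma_bar : inX sigma_bar.
Proof.
exists Li; first exact: inV_Li.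
by rewrite ccw_vstack ccw_sigma ccw_rho.
Qed.
Lemma inX_rho : inX rho.
Proof.
exists 1v; first exact: inV_one.
by rewrite hstack_rho_rho ccw_vertical_strands.
Qed.

(** * Closed components *)

(* A colouring of the strands which vanishes at the ends and not everywhere shows
   a closed component, and conversely. *)
Definition row_step (s : event) (r r' : seq bool) : Prop :=
  exists a b : seq bool, size a = s.1 /\
    match s.2 with
    | Cross _ => exists x y, r = a ++ x :: y :: b /\ r' = a ++ y :: x :: b
    | Cap => exists x, r = a ++ b /\ r' = a ++ x :: x :: b
    | Cup => exists x, r = a ++ x :: x :: b /\ r' = a ++ b
    end.

Fixpoint coloured (w : seq event) (r r' : seq bool) : Prop :=
  if w is s :: w' then exists2 r1,
    row_step s r r1 & coloured w' r1 r' else r = r'.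

Definition has_loop (w : seq event) : Prop :=
  exists w1 w2 r, [/\ w = w1 ++ w2, coloured w1 [:: false; false] r,
    coloured w2 r [:: false; false] & true \in r].

Lemma coloured_cat w1 w2 r r1 r2 :
  coloured w1 r r1 -> coloured w2 r1 r2 -> coloured (w1 ++ w2) r r2.
Proof.
elim: w1 r => [|s w1 IH] r /=; first by move->.
by case=> r0 sr /IH IH1 /IH1 c; exists r0.
Qed.

Lemma row_step_size s r r' : row_step s r r' -> size r' = next_width (size r) s.
Proof.
case: s => i p [a [b [/= sa]]]; rewrite /next_width /=.
case: p => [c [x [y [-> ->]]]|[x [-> ->]]|[x [-> ->]]]; rewrite !size_cat /=;
  lia.
Qed.

Lemma coloured_size w r r' : coloured w r r' -> size r' = width (size r) w.
Proof.
elim: w r => [|s w IH] r /=; first by move->.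
by case=> r1 /row_step_size <- /IH.
Qed.

Lemma coloured_rows w r r' : coloured w r r' ->
  exists rows : nat -> seq bool, [/\ rows 0 = r, rows (size w) = r' &
    forall k, k < size w -> row_step (nth (0, Cap) w k) (rows k) (rows k.+1)].
Proof.
elim: w r => [|s w IH] r /=; first by move=> <-; exists (fun=> r).
case=> r1 sr /IH [rows [r0 rn rk]].
exists (fun k => if k is k'.+1 then rows k' else r); split=> // -[|k] //=.
  by rewrite r0.
exact: rk.
Qed.

(** [ArcRight] also joins positions beyond the width; there both colours are the default [false]. *)
Lemma row_step_arc w rows :
  (forall k, k < size w -> row_step (nth (0, Cap) w k) (rows k) (rows k.+1)) ->
  forall p q, Defs.arc w p q ->
    nth false (rows p.1) p.2 = nth false (rows q.1) q.2.
Proof.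
move=> wk p q [k i t j kw e ji|k i t j kw e|k i c kw e|k i c kw e|k i kw e|k i
  kw e] /=;
  have := wk k kw; rewrite e; case=> a [b [/= sa]].
- by case: t {e} => [c [x [y [-> ->]]]|[x [-> ->]]|[x [-> ->]]];
    rewrite !nth_cat sa ji.
- case: t {e} => [c [x [y [-> ->]]]|[x [-> ->]]|[x [-> ->]]] /=;
  by rewrite !nth_cat sa !ltnNge -!addnA leq_addr /= addKn ?add0n ?addn0
    ?leq_addr ?addKn /= ?add2n.
- case=> x [y [-> ->]]; rewrite !nth_cat sa ltnn subnn ltnNge leqnSn /= subSnn
    //.
- case=> x [y [-> ->]]; rewrite !nth_cat sa ltnn subnn ltnNge leqnSn /= subSnn
    //.
- by case=> x [_ ->]; rewrite !nth_cat sa ltnn subnn ltnNge leqnSn /= subSnn.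
- by case=> x [-> _]; rewrite !nth_cat sa ltnn subnn ltnNge leqnSn /= subSnn.
Qed.

Lemma has_loop_component (T : tangle) : has_loop T ->
  ~ without_closed_components T.
Proof.
case=> w1 [w2 [r [wE c1 c2 tr]]] wcc.
have [rows1 [r10 r1n r1k]] := coloured_rows c1.
have [rows2 [r20 r2n r2k]] := coloured_rows c2.
pose rows k := if k < size w1 then rows1 k else rows2 (k - size w1).
have rk k : k < size T -> row_step (nth (0, Cap) T k) (rows k) (rows k.+1).
  rewrite wE size_cat nth_cat /rows => kT; case: ltnP => k1.
    case: ltnP => [_|k1']; first exact: r1k.
    have e : k.+1 = size w1 by apply/eqP; rewrite eqn_leq k1 k1'.
    by rewrite e subnn r20 -r1n -e; exact: r1k.
  rewrite ltnNge (leq_trans k1 (leqnSn _)) /= subSn //; apply: r2k.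
  by rewrite -(ltn_add2l (size w1)) subnKC.
have P p q : same_component T p q ->
    nth false (rows p.1) p.2 = nth false (rows q.1) q.2.
  elim=> [{}p {}q /(row_step_arc rk)//|//|{}p {}q _ -> //|{}p p' {}q _ ->
    _ -> //].
(* The position [j'] on the boundary is not bounded by the width, so the default value has to agree
   with the colour of the ends. *)
have f j : nth false [:: false; false] j = false by case: j => [|[|[]]].
have [||k' [j' [b /P/=]]] := wcc (size w1) (index true r).
- by rewrite wE size_cat leq_addr.
- by rewrite wE take_size_cat // -(coloured_size c1) index_mem.
have -> : rows (size w1) = r by rewrite /rows ltnn subnn.
rewrite nth_index //; case: b => ->.
  rewrite /rows; case: ltnP => [_|]; first by rewrite r10 f.
  by rewrite leqn0 => /nilP w10; move: c1; rewrite w10 sub0n r20 /= => <-;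
    rewrite f.
by rewrite wE size_cat /rows ltnNge leq_addr /= addKn r2n f.
Qed.

Lemma mkseqD (A : Type) (f : nat -> A) m n :
  mkseq f (m + n) = mkseq f m ++ mkseq (fun j => f (m + j)) n.
Proof.
by rewrite /mkseq iotaD map_cat add0n -[X in iota X n]addn0 iotaDl -map_comp.
Qed.

Lemma width_cat m u v : width m (u ++ v) = width (width m u) v.
Proof. exact: foldl_cat. Qed.

Lemma fits_catP m u v n :
  fits m (u ++ v) n -> fits m u (width m u) /\ fits (width m u) v n.
Proof.
elim: u m => [|s u IH] m /=; first by rewrite eqxx.
by case/andP=> -> /IH.
Qed.

Lemma loop_free_components (T : tangle) : ~ has_loop T ->
  without_closed_components T.
Proof.
move=> ncl k j kT jk; apply: contrapT => nb.
(* The component of [(k, j)] is coloured [true]; by assumption it misses both ends. *)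
pose P k' j' := `[< same_component T (k, j) (k', j') >].
pose rows k' := mkseq (P k') (width 2 (take k' T)).
have Parc p q : Defs.arc T p q -> P p.1 p.2 = P q.1 q.2.
  case: p q => [k1 j1] [k2 j2] /= pq; apply/asboolP/asboolP => c.
    by apply: rst_trans c _; apply: rst_step.
  by apply: rst_trans c _; apply: rst_sym; apply: rst_step.
have Pb k' j' : k' = 0 \/ k' = size T -> P k' j' = false.
  by move=> b; apply/asboolP => c; apply: nb; exists k', j'.
have rowsb k' : k' = 0 \/ k' = size T -> width 2 (take k' T) = 2 ->
    rows k' = [:: false; false].
  by move=> b w2; rewrite /rows w2 /mkseq /= !Pb.
have step k' : k' < size T -> row_step (nth (0,
  Cap) T k') (rows k') (rows k'.+1).
  move=> k'T; case e: (nth _ _ _) => [i p].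
  have [t [ip wt]] : exists t, width 2 (take k' T) = i + (ins p + t) /\
     width 2 (take k'.+1 T) = i + (outs p + t).
    have := word_fits T; rewrite -{1}(cat_take_drop k' T) => /fits_catP[_].
    rewrite (drop_nth (0, Cap)) // e /= => /andP[ipw _].
    exists (width 2 (take k' T) - (i + ins p)).
    rewrite (take_nth (0, Cap)) // -cats1 width_cat e /= /next_width /=.
    by move: ipw; set m := width _ _ => ipw; lia.
  rewrite /rows wt ip; exists (mkseq (P k') i),
    (mkseq (fun j => P k' (i + ins p + j)) t).
  rewrite size_mkseq; split=> //.
  have El : mkseq (P k'.+1) i = mkseq (P k') i.
    by apply/eq_in_map => j'; rewrite mem_iota add0n => ji;
      rewrite -(Parc _ _ (ArcLeft k'T e ji)).
  have Er : mkseq (fun j => P k'.+1 (i + outs p + j)) t = mkseq (fun j => P k'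
    (i + ins p + j)) t.
    by apply: eq_map => j'; rewrite -(Parc _ _ (ArcRight j' k'T e)).
  have E k2 o : mkseq (P k2) (i + (o + t)) =
     mkseq (P k2) i ++ mkseq (fun j => P k2 (i + j)) o ++ mkseq (fun j => P k2
       (i + o + j)) t.
    by rewrite !mkseqD; congr (_ ++ (_ ++ _)); apply: eq_map => j';
      rewrite addnA.
  rewrite !E El Er; case: p e {ip wt El Er} => [c||] e /=.
  - exists (P k' i), (P k' i.+1); rewrite /mkseq /= !addn0 !addn1.
    by rewrite -(Parc _ _ (ArcFall k'T e)) -(Parc _ _ (ArcRise k'T e)).
  - exists (P k'.+1 i); rewrite /mkseq /= !addn0 !addn1.
    by rewrite -(Parc _ _ (ArcCap k'T e)).
  - exists (P k' i); rewrite /mkseq /= !addn0 !addn1.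
    by rewrite -(Parc _ _ (ArcCup k'T e)).
have col k1 n : k1 + n <= size T ->
  coloured (take n (drop k1 T)) (rows k1) (rows (k1 + n)).
  elim: n k1 => [|n IH] k1 k1n; first by rewrite take0 addn0.
  have k1T : k1 < size T by apply: leq_trans k1n; rewrite addnS ltnS leq_addr.
  rewrite (drop_nth (0, Cap)) //=; exists (rows k1.+1); first exact: step.
  by rewrite -addSnnS; apply: IH; rewrite addSnnS.
apply: ncl; exists (take k T), (drop k T), (rows k).
have wT : width 2 T = 2.
  have := word_fits T; rewrite -{1}[word T]cats0 => /fits_catP[_ /=] /eqP //.
split.
- by rewrite cat_take_drop.
- by have := col 0 k; rewrite drop0 add0n rowsb ?take0 //; [apply | left].
- have := col k (size T - k); rewrite subnKC // => /(_ (leqnn _)).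
  by rewrite -size_drop take_size (rowsb (size T));
    [ | right | rewrite take_size].
- apply/mapP; exists j; first by rewrite mem_iota.
  by apply/esym/asboolP; apply: rst_refl.
Qed.

(** * Checking by computation that a diagram has no closed component *)

Definition next_rows (s : event) (r : seq bool) : seq (seq bool) :=
  let a := take s.1 r in
  match s.2, drop s.1 r with
  | Cross _, x :: y :: b => [:: a ++ y :: x :: b]
  | Cap, b => [:: a ++ true :: true :: b; a ++ false :: false :: b]
  | Cup, x :: y :: b => if x == y then [:: a ++ b] else [::]
  | _, _ => [::]
  end.

Lemma next_rowsP s r r' : row_step s r r' -> r' \in next_rows s r.
Proof.
case: s => i p [a [b [/= <-]]]; rewrite /next_rows /=.
case: p => [c [x [y [-> ->]]]|[x [-> ->]]|[x [-> ->]]];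
  rewrite take_size_cat // drop_size_cat // ?eqxx ?inE //.
by case: x; rewrite eqxx ?orbT.
Qed.

(** An exhaustive search over the colourings that begin with [r]: the flag [seen] remembers a strand
    coloured [true], and the search fails on a colouring which has met one and ends in a row without
    [true]. *)
Fixpoint loop_free (w : seq event) (r : seq bool) (seen : bool) : bool :=
  let seen := seen || has id r in
  if w is s :: w' then all (fun r' => loop_free w' r' seen) (next_rows s r)
  else ~~ seen || has id r.

Lemma loop_free_seen w r :
  loop_free w r true -> ~ coloured w r [:: false; false].
Proof.
elim: w r => [|s w IH] r /=; first by move=> h e; move: h; rewrite e.
by move=> /allP cf [r1 /next_rowsP/cf/IH].
Qed.

Lemma loop_freeP w : loop_free w [:: false; false] false -> ~ has_loop w.
Proof.
move=> cf [w1 [w2 [r [wE c1 c2 tr]]]]; rewrite {}wE in cf.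
have suffix r0 seen : loop_free (w1 ++ w2) r0 seen -> coloured w1 r0 r ->
    exists seen', loop_free w2 r seen'.
  elim: w1 r0 seen {cf c1} => [|s w1 IH] r0 seen /=.
    by move=> cf r0r; exists seen; rewrite -r0r.
  by move=> /allP cf [r1 /next_rowsP/cf cf1]; exact: IH cf1.
have [seen] := suffix _ _ cf c1.
have hr : has id r by apply/hasP; exists true.
(* The row [r] contains [true], so the flag is raised there whatever came before. *)
have -> : loop_free w2 r seen = loop_free w2 r true.
  by case: (w2) => [|s w'] /=; rewrite hr orbT.
by move/loop_free_seen; apply.
Qed.

(** * Types of algebraic tangles *)

Lemma row_step_shift a s r r' :
  row_step s r r' -> row_step (size a + s.1, s.2) (a ++ r) (a ++ r').
Proof.
case: s => i p [a0 [b [/= <- h]]]; exists (a ++ a0), b; rewrite size_cat;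
  split=> //=.
case: p h => [c [x [y [-> ->]]]|[x [-> ->]]|[x [-> ->]]].
- by exists x, y; rewrite -!catA.
- by exists x; rewrite -!catA.
- by exists x; rewrite -!catA.
Qed.

Lemma row_step_right b s r r' : row_step s r r' ->
  row_step s (r ++ b) (r' ++ b).
Proof.
case: s => i p [a0 [b0 [/= <- h]]]; exists a0, (b0 ++ b); split=> //=.
case: p h => [c [x [y [-> ->]]]|[x [-> ->]]|[x [-> ->]]].
- by exists x, y; rewrite -!catA.
- by exists x; rewrite -!catA.
- by exists x; rewrite -!catA.
Qed.

Lemma coloured_shift a w r r' :
  coloured w r r' -> coloured (shift (size a) w) (a ++ r) (a ++ r').
Proof.
elim: w r => [|s w IH] r /=; first by move->.
by case=> r1 /(row_step_shift a) sr /IH; exists (a ++ r1).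
Qed.

Lemma coloured_right b w r r' : coloured w r r' ->
  coloured w (r ++ b) (r' ++ b).
Proof.
elim: w r => [|s w IH] r /=; first by move->.
by case=> r1 /(row_step_right b) sr /IH; exists (r1 ++ b).
Qed.

Lemma coloured_negb w r r' :
  coloured w r r' -> coloured w (map negb r) (map negb r').
Proof.
elim: w r => [|[i p] w IH] r /=; first by move->.
case=> r1 [a [b [/= sa h]]] /IH c; exists (map negb r1) => //.
exists (map negb a), (map negb b); rewrite size_map; split=> //=.
case: p h => [t [x [y [-> ->]]]|[x [-> ->]]|[x [-> ->]]].
- by exists (~~ x), (~~ y); rewrite !map_cat.
- by exists (~~ x); rewrite !map_cat.
- by exists (~~ x); rewrite !map_cat.
Qed.

Lemma coloured_const b w m n : fits m w n -> coloured w (nseq m b) (nseq n b).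
Proof.
elim: w m => [|[i p] w IH] m /=; first by move/eqP->.
case/andP=> im /IH c; exists (nseq (next_width m (i, p)) b) => //.
exists (nseq i b), (nseq (m - (i + ins p)) b); rewrite size_nseq; split=> //=.
have mE : m = i + (ins p + (m - (i + ins p))) by lia.
have nE : next_width m (i, p) = i + (outs p + (m - (i + ins p))).
  by rewrite /next_width /=; lia.
have -> : nseq m b = nseq i b ++ nseq (ins p) b ++ nseq (m - (i + ins p)) b.
  by rewrite {1}mE !nseqD.
have -> : nseq (next_width m (i, p)) b =
    nseq i b ++ nseq (outs p) b ++ nseq (m - (i + ins p)) b.
  by rewrite nE !nseqD.
by case: (p) => [t||]; [exists b, b | exists b | exists b].
Qed.

Lemma coloured_constT b (T : tangle) : coloured T [:: b; b] [:: b; b].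
Proof. exact: (coloured_const b (word_fits T)). Qed.

Lemma coloured_cap x a b : coloured [:: (1, Cap)] [:: a; b] [:: a; x; x; b].
Proof.
by exists [:: a; x; x; b] => //; exists [:: a], [:: b]; split=> //; exists x.
Qed.

Lemma coloured_cup x a b : coloured [:: (1, Cup)] [:: a; x; x; b] [:: a; b].
Proof. by exists [:: a; b] => //; exists [:: a], [:: b]; split=> //;
  exists x. Qed.

(** [x] and [y] are the colours of the two junctions between [A] and [B], at the maximum and at the
    minimum. *)
Lemma coloured_hstack x y a b c d (A B : tangle) :
  coloured A [:: a; x] [:: c; y] -> coloured B [:: x; b] [:: y; d] ->
  coloured (A ⊖ B) [:: a; b] [:: c; d].
Proof.
move=> cA cB; apply: coloured_cat (coloured_cap x a b) _.
apply: coloured_cat (coloured_right [:: x; b] cA) _.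
exact: coloured_cat (coloured_shift [:: c; y] cB) (coloured_cup y c d).
Qed.

Lemma has_loop_vstackl (A B : tangle) : has_loop A -> has_loop (A ⊚ B).
Proof.
case=> w1 [w2 [r [AE c1 c2 tr]]]; exists w1, (w2 ++ B), r; split=> //.
  by rewrite /= AE catA.
exact: coloured_cat c2 (coloured_constT false B).
Qed.

Lemma has_loop_vstackr (A B : tangle) : has_loop B -> has_loop (A ⊚ B).
Proof.
case=> w1 [w2 [r [BE c1 c2 tr]]]; exists (A ++ w1), w2, r; split=> //.
  by rewrite /= BE catA.
exact: coloured_cat (coloured_constT false A) c1.
Qed.

Lemma has_loop_hstackl (A B : tangle) : has_loop A -> has_loop (A ⊖ B).
Proof.
case=> w1 [w2 [r [AE c1 c2 tr]]].
exists ((1, Cap) :: w1), (w2 ++ shift 2 B ++ [:: (1, Cup)]), (r ++ [:: false;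
  false]).
split.
- by rewrite /= /hcat AE -catA.
- exact: coloured_cat (coloured_cap false _ _) (coloured_right [:: false;
    false] c1).
- apply: coloured_cat (coloured_right [:: false; false] c2) _.
  apply: coloured_cat (coloured_shift [:: false;
    false] (coloured_constT false B)) _.
  exact: (coloured_cup false).
- by rewrite mem_cat tr.
Qed.

Lemma has_loop_hstackr (A B : tangle) : has_loop B -> has_loop (A ⊖ B).
Proof.
case=> w1 [w2 [r [BE c1 c2 tr]]].
exists ((1, Cap) :: A ++ shift 2 w1), (shift 2 w2 ++ [:: (1, Cup)]),
  ([:: false; false] ++ r).
split.
- by rewrite /= /hcat BE shift_cat -!catA.
- apply: coloured_cat (coloured_cap false _ _) _.
  apply: coloured_cat (coloured_right [:: false;
    false] (coloured_constT false A)) _.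
  exact: (coloured_shift [:: false; false] c1).
- apply: coloured_cat (coloured_shift [:: false; false] c2) _.
  exact: (coloured_cup false).
- by rewrite mem_cat tr orbT.
Qed.

(** The three pairings of the corners by the two intervals, each witnessed by a colouring that gives
    the intervals different colours. *)
Definition joinsV (T : tangle) : Prop :=
  coloured T [:: false; true] [:: false; true].
Definition joinsH (T : tangle) : Prop :=
  coloured T [:: false; false] [:: true; true].
Definition joinsX (T : tangle) : Prop :=
  coloured T [:: false; true] [:: true; false].

Lemma has_loop_HH (A B : tangle) : joinsH A -> joinsH B -> has_loop (A ⊚ B).
Proof.
move=> cA /coloured_negb cB; exists A, B, [:: true; true]; split=> //.
Qed.

Lemma has_loop_VV (A B : tangle) : joinsV A -> joinsV B -> has_loop (A ⊖ B).
Proof.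
move=> cA /coloured_negb cB.
exists [:: (1, Cap)], (A ++ shift 2 B ++ [:: (1, Cup)]), [:: false; true;
  true; false].
split=> //; first exact: coloured_cap.
apply: coloured_cat (coloured_right [:: true; false] cA) _.
exact: coloured_cat (coloured_shift [:: false;
  true] cB) (coloured_cup true _ _).
Qed.

(** The type concerns the class of [T], while the loop and the pairing concern the diagram itself;
    the pairing excludes H ⊚ H and V ⊖ V unless a loop appears. *)
Inductive normal (T : tangle) : Prop :=
| NormalClosed of has_loop T
| NormalX of inX T & joinsX T
| NormalH of inH T & joinsH T
| NormalV of inV T & joinsV T.

Lemma normal_hstack A B : normal A -> normal B -> normal (A ⊖ B).
Proof.
case=> [cA|XA jA|HA jA|VA jA]; first by move=> _;
  apply/NormalClosed/has_loop_hstackl.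
all: case=> [cB|XB jB|HB jB|VB jB]; first exact/NormalClosed/has_loop_hstackr.
- apply: NormalH (hstackXX XA XB) _.
  exact: coloured_hstack jA (coloured_negb jB).
- apply: NormalX (hstackXH XA HB) _.
  exact: coloured_hstack jA (coloured_negb jB).
(* The whole of [A] is attached to the left strand of [B], hence one constant colour on [A]. *)
- apply: NormalV (hstackXV XA VB) _.
  exact: coloured_hstack (coloured_constT false A) jB.
- apply: NormalX (hstackHX HA XB) _.
  exact: coloured_hstack jA jB.
- apply: NormalH (hstackHH HA HB) _.
  exact: coloured_hstack jA jB.
- apply: NormalV (hstackHV HA VB) _.
  exact: coloured_hstack (coloured_constT false A) jB.
- apply: NormalV (hstackVX VA XB) _.
  exact: coloured_hstack jA (coloured_constT true B).
- apply: NormalV (hstackVH VA HB) _.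
  exact: coloured_hstack jA (coloured_constT true B).
- exact/NormalClosed/has_loop_VV.
Qed.

Lemma normal_vstack A B : normal A -> normal B -> normal (A ⊚ B).
Proof.
case=> [cA|XA jA|HA jA|VA jA]; first by move=> _;
  apply/NormalClosed/has_loop_vstackl.
all: case=> [cB|XB jB|HB jB|VB jB]; first exact/NormalClosed/has_loop_vstackr.
- apply: NormalV; last exact: coloured_cat jA (coloured_negb jB).
  apply/inH_ccw; rewrite ccw_vstack; apply: hstackXX; exact/inX_ccw.
- apply: NormalH; last exact: coloured_cat (coloured_constT false A) jB.
  by apply/inV_ccw; rewrite ccw_vstack; apply: hstackXV;
    [exact/inX_ccw | exact/inV_ccw].
- apply: NormalX; last exact: coloured_cat jA (coloured_negb jB).
  by apply/inX_ccw; rewrite ccw_vstack; apply: hstackXH;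
    [exact/inX_ccw | exact/inH_ccw].
- apply: NormalH; last exact: coloured_cat jA (coloured_constT true B).
  by apply/inV_ccw; rewrite ccw_vstack; apply: hstackVX;
    [exact/inV_ccw | exact/inX_ccw].
- exact/NormalClosed/has_loop_HH.
- apply: NormalH; last exact: coloured_cat jA (coloured_constT true B).
  by apply/inV_ccw; rewrite ccw_vstack; apply: hstackVH;
    [exact/inV_ccw | exact/inH_ccw].
- apply: NormalX; last exact: coloured_cat jA jB.
  by apply/inX_ccw; rewrite ccw_vstack; apply: hstackHX;
    [exact/inH_ccw | exact/inX_ccw].
- apply: NormalH; last exact: coloured_cat (coloured_constT false A) jB.
  by apply/inV_ccw; rewrite ccw_vstack; apply: hstackHV;
    [exact/inH_ccw | exact/inV_ccw].
- apply: NormalV; last exact: coloured_cat jA jB.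
  by apply/inH_ccw; rewrite ccw_vstack; apply: hstackHH; exact/inH_ccw.
Qed.

Lemma joinsX_elementary c : joinsX (elementary c).
Proof.
by exists [:: true; false] => //; exists [::], [::]; split=> //;
  exists false, true.
Qed.

Lemma normal_algebraic T : algebraic T -> normal T.
Proof.
elim=> [|||A B _ NA _ NB|A B _ NA _ NB].
- exact: NormalX inX_sigma (joinsX_elementary _).
- exact: NormalX inX_sigma_bar (joinsX_elementary _).
- exact: NormalX inX_rho (joinsX_elementary _).
- exact: normal_vstack.
- exact: normal_hstack.
Qed.

(* The crossingless zeroth powers are not algebraic, but equivalent to a product
   of two virtual crossings. *)
Definition algebraic_hpower (T : tangle) (u : nat) : tangle :=
  if u is 0 then rho ⊖ rho else hpower T u.
Definition algebraic_vpower (T : tangle) (u : nat) : tangle :=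
  if u is 0 then rho ⊚ rho else vpower T u.

Lemma algebraic_hpowerE T u : algebraic_hpower T u ≈ hpower T u.
Proof. by case: u => //; exact: hstack_rho_rho. Qed.
Lemma algebraic_vpowerE T u : algebraic_vpower T u ≈ vpower T u.
Proof. by case: u => //; exact: rho_rho. Qed.

Lemma algebraic_hpowerP T u : algebraic T -> algebraic (algebraic_hpower T u).
Proof.
move=> aT; case: u => [|u]; first exact: AlgHstack AlgRho AlgRho.
by elim: u => // u IH; exact: AlgHstack.
Qed.
Lemma algebraic_vpowerP T u : algebraic T -> algebraic (algebraic_vpower T u).
Proof.
move=> aT; case: u => [|u]; first exact: AlgVstack AlgRho AlgRho.
by elim: u => // u IH; exact: AlgVstack.
Qed.

Definition algebraicH (u v : nat) : tangle :=
  algebraic_hpower U u ⊖ algebraic_hpower D v.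
Definition algebraicX (u v : nat) : tangle := algebraicH u v ⊖ rho.
Definition algebraicV (u v : nat) : tangle :=
  algebraic_vpower R u ⊚ algebraic_vpower L v.

Lemma algebraic_without_closed_components u v : u < 4 -> v < 4 ->
  [/\ without_closed_components (algebraicX u v),
      without_closed_components (algebraicH u v) &
      without_closed_components (algebraicV u v)].
Proof.
pose free (T : nat -> nat -> tangle) u v := loop_free (T u v) [:: false;
  false] false.
(* The search is run on all 48 diagrams. *)
have : all (fun T => all (fun u => all (free T u) (iota 0 4)) (iota 0 4))
    [:: algebraicX; algebraicH; algebraicV].
  by vm_compute.
have in4 n : n < 4 -> n \in iota 0 4 by rewrite mem_iota.
case/and4P=> /allP fX /allP fH /allP fV _ /in4 u4 /in4 v4.
split; apply/loop_free_components/loop_freeP.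
- exact: (allP (fX _ u4) _ v4).
- exact: (allP (fH _ u4) _ v4).
- exact: (allP (fV _ u4) _ v4).
Qed.

Lemma wink_class_eq T T' : T ≈ T' -> wink_class T = wink_class T'.
Proof.
move=> TT'; apply/seteqP; split=> T2 /= e; last exact: rst_trans TT' e.
exact: rst_trans (rst_sym _ _ _ _ TT') e.
Qed.

Lemma algebraic_classes_normal : algebraic_classes =
    [set C | exists u v : 'I_4,
       C = wink_class (tangleX u v) \/
       C = wink_class (tangleH u v) \/
       C = wink_class (tangleV u v)]%classic.
Proof.
have aR : algebraic R by apply: AlgVstack AlgSigmaBar AlgRho.
have aL : algebraic L by apply: AlgVstack AlgRho AlgSigmaBar.
have aU : algebraic U by apply: AlgHstack AlgSigma AlgRho.
have aD : algebraic D by apply: AlgHstack AlgRho AlgSigma.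
apply/seteqP; split=> [_ [T [aT wT] <-]|C [u [v uv]]] /=.
  case: (normal_algebraic aT) => [cT|/inXP|/inHP|[u [v [u4 v4 e]]] _].
  - by case: (has_loop_component cT wT).
  - case=> u [v [u4 v4 e]] _; exists (Ordinal u4), (Ordinal v4).
    by left; exact: wink_class_eq.
  - case=> u [v [u4 v4 e]] _; exists (Ordinal u4), (Ordinal v4).
    by right; left; exact: wink_class_eq.
  - exists (Ordinal u4), (Ordinal v4).
    by right; right; exact: wink_class_eq.
have [wX wH wV] := algebraic_without_closed_components (ltn_ord u) (ltn_ord v).
have aH : algebraic (algebraicH u v).
  by apply: AlgHstack; exact: algebraic_hpowerP.
have eH : algebraicH u v ≈ tangleH u v.
  by rewrite /algebraicH !algebraic_hpowerE.
case: uv => [->|[->|->]].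
- exists (algebraicX u v); first by split=> //; apply: AlgHstack aH AlgRho.
  by apply: wink_class_eq; rewrite /algebraicX eH.
- by exists (algebraicH u v); [ | exact: wink_class_eq].
- exists (algebraicV u v).
    by split=> //; apply: AlgVstack; exact: algebraic_vpowerP.
  by apply: wink_class_eq; rewrite /algebraicV !algebraic_vpowerE.
Qed.

Theorem theorem2p7 :
  finite_set algebraic_classes /\
  algebraic_classes =
    [set C | exists u v : 'I_4,
       C = wink_class (tangleX u v) \/
       C = wink_class (tangleH u v) \/
       C = wink_class (tangleV u v)]%classic.
Proof.
split; last exact: algebraic_classes_normal.
rewrite algebraic_classes_normal.
(* The third coordinate selects the family, so the classes lie in the range of a map from a finite
   type. *)
pose f (p : 'I_4 * 'I_4 * 'I_3) := wink_class
  (nth tangleX [:: tangleX; tangleH; tangleV] p.2 p.1.1 p.1.2).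
apply: (@sub_finite_set _ _ (range f)).
  move=> C [u [v [|[|]]]] ->.
  - by exists (u, v, inord 0) => //; rewrite /f /= inordK.
  - by exists (u, v, inord 1) => //; rewrite /f /= inordK.
  - by exists (u, v, inord 2) => //; rewrite /f /= inordK.
exact/finite_image/finite_finset.
Qed.
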